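(* Let $G$ be a step $2$ Carnot group of topological dimension not greater than $7$. Then the abnormal set $\mathrm{Abn}_G$ is contained in an algebraic subvariety of $G$ of codimension at least three.
   Context: A Carnot group of step $2$ is a connected, simply connected Lie group $G$ whose (finite-dimensional real) Lie algebra has a direct sum decomposition $\mathfrak g=V_1\oplus V_2$ with $V_2=[V_1,V_1]\neq\{0\}$ and $[V_2,V_1]=\{0\}$. Denote by $e$ the identity and by $L_g$ left translation by $g$. For $u\in L^2([0,1],V_1)$ let $\gamma_u:[0,1]\to G$ be the absolutely continuous curve with $\gamma_u(0)=e$ and $\dot\gamma_u(t)=(\mathrm dL_{\gamma_u(t)})_e\,u(t)$ for a.e. $t$. The endpoint map is $\mathrm{End}:L^2([0,1],V_1)\to G$, $\mathrm{End}(u)=\gamma_u(1)$. The curve $\gamma_u$ is called abnormal if the image of the differential $\mathrm d\,\mathrm{End}_u$ is a proper subspace of $T_{\gamma_u(1)}G$. The abnormal set is $\mathrm{Abn}_G=\{\gamma(1):\gamma \text{ abnormal},\ \gamma(0)=e\}$, i.e. the set of singular (critical) values of $\mathrm{End}$. The exponential map $\exp:\mathfrak g\to G$ is a diffeomorphism, through which $G$ is identified with the vector space $\mathfrak g$; algebraic subvarieties of $G$ are understood as (real affine) algebraic subvarieties in these coordinates. *)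

(* Defs.v *)
(* multinomials is required without being imported: its notations clash with
   those of MathComp-Analysis. *)
From HB Require Import structures.
From mathcomp Require Import all_boot all_order all_algebra.
From mathcomp Require Import all_classical all_reals all_analysis.
From mathcomp Require Import ring.
From mathcomp Require mpoly.

Set Implicit Arguments.
Unset Strict Implicit.
Unset Printing Implicit Defensive.

Import Order.TTheory GRing.Theory Num.Theory.
Import numFieldNormedType.Exports.

Local Open Scope classical_set_scope.
Local Open Scope ring_scope.

(* The span of all brackets [x, y] with x in U and y in W; by bilinearity,
   bases of U and W suffice. *)
Definition bracket_space (R : realType) (N : nat)
    (br : 'rV[R]_N -> 'rV[R]_N -> 'rV[R]_N) (U W : {vspace 'rV[R]_N}) :
    {vspace 'rV[R]_N} :=
  <<[seq br x y | x <- vbasis U, y <- vbasis W]>>%VS.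

(* A stratified Lie algebra g = V1 (+) V2 of step 2 and dimension N, written in
   a linear basis, i.e. on R^N; neither the bracket nor the layers are assumed
   adapted to the standard basis. *)
Record carnot2 (R : realType) (N : nat) := Carnot2 {
  lie : 'rV[R]_N -> 'rV[R]_N -> 'rV[R]_N;
  lie_linearl : forall y, linear (lie^~ y);
  lie_linearr : forall x, linear (lie x);
  liexx : forall x, lie x x = 0;
  lie_jacobi : forall x y z,
    lie x (lie y z) + lie y (lie z x) + lie z (lie x y) = 0;
  V1 : {vspace 'rV[R]_N};
  V2 : {vspace 'rV[R]_N};
  V12_direct : directv (V1 + V2);
  V12_full : (V1 + V2)%VS = fullv;
  V2_def : V2 = bracket_space lie V1 V1;
  V2_neq0 : V2 <> 0%VS;
  V21_eq0 : bracket_space lie V2 V1 = 0%VS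
}.

Section CarnotGroup.
Context (R : realType) (N : nat) (G : carnot2 R N).
Local Notation g := 'rV[R]_N.

(* The simply connected group of G in exponential coordinates: the carrier is
   the Lie algebra, the identity is 0, and the product is the
   Baker-Campbell-Hausdorff formula, which stops at the first bracket because
   the algebra is nilpotent of step 2. *)
Definition mulG (x y : g) : g := x + y + 2^-1 *: lie G x y.

Lemma lie0l y : lie G 0 y = 0.
Proof.
by have := lie_linearl G y (-1) 0 0; rewrite /= addr0 scaler0 scaleN1r addNr.
Qed.

Lemma lie0r x : lie G x 0 = 0.
Proof.
by have := lie_linearr G x (-1) 0 0; rewrite /= addr0 scaler0 scaleN1r addNr.
Qed.

Lemma lieDl x y z : lie G (x + y) z = lie G x z + lie G y z.
Proof. by have := lie_linearl G z 1 x y; rewrite /= !scale1r. Qed.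

Lemma lieDr x y z : lie G z (x + y) = lie G z x + lie G z y.
Proof. by have := lie_linearr G z 1 x y; rewrite /= !scale1r. Qed.

Lemma lieZl a x z : lie G (a *: x) z = a *: lie G x z.
Proof. by have := lie_linearl G z a x 0; rewrite /= !addr0 lie0l addr0. Qed.

Lemma lieZr a x z : lie G z (a *: x) = a *: lie G z x.
Proof. by have := lie_linearr G z a x 0; rewrite /= !addr0 lie0r addr0. Qed.

Lemma lie_antisym x y : lie G x y = - lie G y x.
Proof.
apply/eqP; rewrite -addr_eq0; apply/eqP.
by have := liexx G (x + y); rewrite lieDl !lieDr !liexx add0r addr0.
Qed.

Lemma mem_bracket_space (U W : {vspace g}) x y :
  x \in U -> y \in W -> lie G x y \in bracket_space (lie G) U W.
Proof.
move=> /coord_vbasis -> /coord_vbasis ->.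
have suml I (r : seq I) (F : I -> g) z :
    lie G (\sum_(i <- r) F i) z = \sum_(i <- r) lie G (F i) z.
  by elim/big_rec2: _ => [|i a b _ <-]; rewrite ?lie0l ?lieDl.
have sumr I (r : seq I) (F : I -> g) z :
    lie G z (\sum_(i <- r) F i) = \sum_(i <- r) lie G z (F i).
  by elim/big_rec2: _ => [|i a b _ <-]; rewrite ?lie0r ?lieDr.
rewrite suml rpred_sum// => i _; rewrite sumr rpred_sum// => j _.
rewrite lieZl lieZr !rpredZ// memv_span//.
by apply/allpairsP; exists ((vbasis U)`_i, (vbasis W)`_j);
  rewrite !mem_nth ?size_tuple.
Qed.

Lemma lie_step2 x y z : lie G x (lie G y z) = 0.
Proof.
have br0 a b : a \in V2 G -> b \in V1 G -> lie G a b = 0.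
  move=> aV bV; apply/eqP; rewrite -memv0 -(V21_eq0 G).
  exact: mem_bracket_space.
have br1 a b : a \in V1 G -> b \in V1 G -> lie G a b \in V2 G.
  by move=> aV bV; rewrite V2_def; exact: mem_bracket_space.
have full a : exists b c, [/\ b \in V1 G, c \in V2 G & a = b + c].
  have : a \in (V1 G + V2 G)%VS by rewrite V12_full memvf.
  by case/memv_addP => b bV [c cV ->]; exists b, c.
have kill a b c : a \in V2 G -> b \in V1 G -> c \in V1 G ->
    lie G a (lie G b c) = 0.
  move=> aV bV cV; have := lie_jacobi G a b c.
  rewrite (br0 a b)// lie0r addr0 (lie_antisym c a) (br0 a c)//.
  by rewrite oppr0 lie0r addr0.
have sumr I (r : seq I) (F : I -> g) t :
    lie G t (\sum_(i <- r) F i) = \sum_(i <- r) lie G t (F i).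
  by elim/big_rec2: _ => [|i a b _ <-]; rewrite ?lie0r ?lieDr.
have br2 a b : a \in V2 G -> b \in V2 G -> lie G a b = 0.
  move=> aV; rewrite V2_def /bracket_space; set s := (X in <<X>>%VS).
  move=> /(@coord_span _ _ _ (in_tuple s)) ->.
  rewrite sumr big1// => i _; rewrite lieZr.
  have /allpairsP [[p q]/= [pV qV ->]] : (in_tuple s)`_i \in s.
    by apply: mem_nth; case: i.
  by rewrite kill ?scaler0// vbasis_mem.
have [y1 [y2 [y1V y2V ->]]] := full y.
have [z1 [z2 [z1V z2V ->]]] := full z.
have [x1 [x2 [x1V x2V ->]]] := full x.
rewrite (lieDl y1) (lieDr z1 z2 y1) (lieDr z1 z2 y2) (br0 y2)// (br2 y2)//.
rewrite (lie_antisym y1 z2) (br0 z2)// oppr0 !addr0 lieDl.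
rewrite (br2 x2) ?br1// addr0 lie_antisym br0 ?br1//.
by rewrite oppr0.
Qed.

Lemma lie_step2l x y z : lie G (lie G x y) z = 0.
Proof. by rewrite lie_antisym lie_step2 oppr0. Qed.

Lemma mul0G x : mulG 0 x = x.
Proof. by rewrite /mulG lie0l scaler0 addr0 add0r. Qed.

Lemma mulG0 x : mulG x 0 = x.
Proof. by rewrite /mulG lie0r scaler0 !addr0. Qed.

Lemma mulGA x y z : mulG x (mulG y z) = mulG (mulG x y) z.
Proof.
rewrite /mulG !lieDr !lieDl lieZr lieZl lie_step2 lie_step2l !scaler0 !addr0.
by apply/rowP => i; rewrite !mxE; ring.
Qed.

Lemma mulGN x : mulG x (- x) = 0.
Proof. by rewrite /mulG -scaleN1r lieZr liexx !scaler0 scaleN1r addr0 subrr. Qed.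

(* t |-> t *: x is a one-parameter subgroup: the exponential map is the
   identity in these coordinates. *)
Lemma mulG_exp x s t : mulG (s *: x) (t *: x) = (s + t) *: x.
Proof. by rewrite /mulG lieZl lieZr liexx !scaler0 addr0 scalerDl. Qed.

Local Notation I01 := (`[0, 1]%classic : set R).
Local Notation mu := (@lebesgue_measure R).

(* Square integrable controls [0, 1] -> V1. Their values outside [0, 1] are
   irrelevant, and so is the choice of a representative modulo null sets. *)
Definition L2control : set (R -> g) :=
  [set u : R -> g | [/\ forall i, measurable_fun I01 (fun t : R => u t 0 i),
               forall i, (\int[mu]_(t in I01) (u t 0 i ^+ 2)%:E < +oo)%E
             & forall t : R, t \in `[0, 1] -> u t \in V1 G]].

Definition L2norm (u : R -> g) : R :=
  Num.sqrt (\sum_i \int[mu]_(t in I01) (u t 0 i ^+ 2)).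

Definition abs_continuous01 (f : R -> g) : Prop :=
  forall e : R, 0 < e -> exists2 d : R, 0 < d &
    forall (n : nat) (a b : 'I_n -> R),
      (forall i, [/\ 0 <= a i, a i <= b i & b i <= 1]) ->
      trivIset setT (fun i => `]a i, b i[%classic) ->
      \sum_i (b i - a i) < d ->
      \sum_i `|f (b i) - f (a i)| < e.

(* gamma starts at the identity and, almost everywhere, its velocity is the
   image of the control under the differential at the identity of the left
   translation by gamma t. *)
Definition lift_of (u gamma : R -> g) : Prop :=
  [/\ gamma 0 = 0, abs_continuous01 gamma &
      {ae mu, forall t : R, t \in `[0, 1] ->
        is_derive t 1 gamma ('d (mulG (gamma t)) (0 : g) (u t))}].

(* Lifts are unique on [0, 1] only; the values of curve u elsewhere are
   unspecified. *)
Definition curve (u : R -> g) : R -> g := get (lift_of u).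

Definition End (u : R -> g) : g := curve u 1.

(* D is the Frechet differential of End at u on the Hilbert space
   L^2([0, 1], V1): a bounded linear map with values in the tangent space of G
   at End u, which is the Lie algebra itself in exponential coordinates. *)
Definition End_differential (u : R -> g) (D : (R -> g) -> g) : Prop :=
  [/\ forall a v w, L2control v -> L2control w ->
        D (a *: v + w) = a *: D v + D w,
      exists C : R, forall v, L2control v -> `|D v| <= C * L2norm v &
      forall e : R, 0 < e -> exists2 d : R, 0 < d &
        forall v, L2control v -> L2norm v < d ->
          `|End (u + v) - End u - D v| <= e * L2norm v].

Definition abnormal (u : R -> g) : Prop :=
  exists2 D, End_differential u D & D @` L2control `<` setT.

Definition Abn : set g :=
  [set p | exists u, [/\ L2control u, abnormal u & p = End u]].

End CarnotGroup.

Section Algebraic.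
Context (R : realType) (N : nat).
Local Notation V := 'rV[R]_N.

Definition algebraic (Z : set V) : Prop :=
  exists P : set (mpoly.mpoly N R),
    Z = [set x | forall p, P p -> mpoly.meval (fun i => x 0 i) p = 0].

Definition irreducible_algebraic (Z : set V) : Prop :=
  [/\ algebraic Z, Z !=set0 &
      forall A B, algebraic A -> algebraic B -> Z = A `|` B -> Z = A \/ Z = B].

(* Z contains a chain C 0 < C 1 < ... < C k of irreducible algebraic sets. *)
Definition has_chain (Z : set V) (k : nat) : Prop :=
  exists C : nat -> set V,
    [/\ forall i, (i <= k)%N -> irreducible_algebraic (C i),
        forall i, (i < k)%N -> C i `<` C i.+1 & C k `<=` Z].

(* N - dim Z >= c, where dim Z is the Krull dimension of Z, i.e. the maximal
   length k of such a chain. *)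
Definition codim_ge (Z : set V) (c : nat) : Prop :=
  forall k, has_chain Z k -> (k + c <= N)%N.

End Algebraic.

(* Main.v *)
(* A control u is abnormal only if some linear form lam <> 0 on the Lie algebra
   kills the image of the differential of End at u. Testing it on the controls
   equal to y on [0, tau] and to 0 afterwards, for which the varied curve is
   explicit, gives lam = 0 on V1 and lam [gamma, y] = 0 along the curve for all
   y in V1. Hence gamma stays in W + [W, W], where W is the kernel in V1 of the
   skew form lam [., .].

   It remains to bound the union over lam of the W + [W, W]. Normalize lam by
   lam (f k) = 1 and choose basis vectors e i, e j with lam [e i, e j] <> 0. The
   elements of W are combinations of dim V1 - 2 vectors polynomial in lam, and
   since N <= 7 the space [W, W] lies on a line through a vector polynomial in
   lam: this makes N - 2 parameters. They satisfy a further polynomial equation: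
   if some 4 x 4 Pfaffian of the skew form is not identically zero in lam, one
   of the equations defining W is not trivial; otherwise polarization gives
   [W, W] = 0 and the parameter on the line vanishes.

   A polynomial image of {q = 0} in R^M, with q <> 0, has dimension less than M:
   M polynomials are always algebraically dependent modulo q, whereas a chain of
   M + 1 irreducible algebraic sets yields M polynomials that are algebraically
   independent on the largest of them. *)
From HB Require Import structures.
Require Import Defs.
From mathcomp Require Import all_boot all_order all_algebra.
From mathcomp Require Import all_classical all_reals all_analysis.
From mathcomp Require Import measurable_realfun ring lra zify.
From mathcomp Require Import -(notations) mpoly.

Set Implicit Arguments.
Unset Strict Implicit.
Unset Printing Implicit Defensive.

Import Order.TTheory GRing.Theory Num.Theory.
Import numFieldNormedType.Exports.

Local Open Scope classical_set_scope.
Local Open Scope ring_scope.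

(** * Polynomials in n variables as iterated univariate polynomials *)

Section NestedPolynomials.
Variable R : numDomainType.

(** The last variable is outermost, so that induction on n can use the univariate theory, such as
    the factor theorem. *)
Fixpoint npoly (n : nat) : idomainType :=
  if n is n'.+1 then {poly npoly n'} else R.

Fixpoint npconst (n : nat) : {rmorphism R -> npoly n} :=
  match n return {rmorphism R -> npoly n} with
  | 0 => idfun
  | n'.+1 => @polyC (npoly n') \o npconst n'
  end.

Fixpoint npvar (n i : nat) : npoly n :=
  match n return npoly n with
  | 0 => 0
  | n'.+1 => if i == n' then 'X else (npvar n' i)%:P
  end.

Section Substitution.
Variables (A : comNzRingType) (iota : {rmorphism R -> A}) (f : nat -> A).

Fixpoint npsubst (n : nat) : {rmorphism npoly n -> A} :=
  match n return {rmorphism npoly n -> A} with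
  | 0 => iota
  | n'.+1 => horner_eval (f n') \o map_poly (npsubst n')
  end.

Lemma npsubstS n (P : npoly n.+1) :
  npsubst n.+1 P = (map_poly (npsubst n) P).[f n].
Proof. by []. Qed.

Lemma npsubst_const n c : npsubst n (npconst n c) = iota c.
Proof.
by elim: n => //= n IH; rewrite /horner_eval map_polyC/= hornerC.
Qed.

Lemma npsubst_var n i : (i < n)%N -> npsubst n (npvar n i) = f i.
Proof.
elim: n => //= n IH; rewrite ltnS leq_eqVlt /horner_eval; case: eqP => [-> _|_ /= ltin].
  by rewrite map_polyX hornerX.
by rewrite map_polyC/= hornerC IH.
Qed.

End Substitution.

Lemma npsubst_comp (A B : comNzRingType) (iota : {rmorphism R -> A})
    (iota' : {rmorphism R -> B}) (g : {rmorphism A -> B})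
    (f : nat -> A) (f' : nat -> B) n (P : npoly n) :
    (forall c, g (iota c) = iota' c) ->
    (forall i, (i < n)%N -> g (f i) = f' i) ->
  g (npsubst iota f n P) = npsubst iota' f' n P.
Proof.
move=> giota; elim: n P => [|n IH] P gf; first exact: giota.
rewrite !npsubstS -horner_map/= gf//; congr (_.[_]).
rewrite -map_poly_comp; apply: eq_map_poly => c /=.
by apply: IH => i ltin; apply: gf; rewrite ltnS ltnW.
Qed.

Definition npeval n (x : nat -> R) : npoly n -> R := npsubst idfun x n.

(** The degree is bounded in each variable separately: such polynomials have exactly (e + 1) ^ n
    coefficients. *)
Fixpoint npdeg_le (n e : nat) : npoly n -> Prop :=
  match n return npoly n -> Prop with
  | 0 => fun=> True
  | n'.+1 => fun P => (size P <= e.+1)%N /\ forall i, npdeg_le e (P`_i : npoly n')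
  end.

Lemma npdeg_le0 n e : npdeg_le e (0 : npoly n).
Proof. by elim: n => //= n IH; split=> [|i]; rewrite ?size_poly0 ?coef0. Qed.

Lemma npdeg_leD n e (P Q : npoly n) :
  npdeg_le e P -> npdeg_le e Q -> npdeg_le e (P + Q).
Proof.
elim: n P Q => //= n IH P Q [sP cP] [sQ cQ]; split=> [|i]; last by rewrite coefD; apply: IH.
by apply: leq_trans (size_polyD _ _) _; rewrite geq_max sP.
Qed.

Lemma npdeg_leN n e (P : npoly n) : npdeg_le e P -> npdeg_le e (- P).
Proof.
by elim: n P => //= n IH P [sP cP]; split=> [|i]; rewrite ?size_polyN// coefN; apply: IH.
Qed.

Lemma npdeg_le_sum n e I (r : seq I) (p : pred I) (F : I -> npoly n) :
  (forall i, p i -> npdeg_le e (F i)) -> npdeg_le e (\sum_(i <- r | p i) F i).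
Proof.
by move=> H; elim/big_rec: _ => [|i x pi]; [exact: npdeg_le0|apply/npdeg_leD/H].
Qed.

Lemma npdeg_le_trans n e e' (P : npoly n) :
  (e <= e')%N -> npdeg_le e P -> npdeg_le e' P.
Proof.
move=> ee'; elim: n P => //= n IH P [sP cP]; split=> [|i]; last exact: IH.
exact: leq_trans sP _.
Qed.

Lemma npdeg_leM n a b (P Q : npoly n) :
  npdeg_le a P -> npdeg_le b Q -> npdeg_le (a + b) (P * Q).
Proof.
elim: n P Q => //= n IH P Q [sP cP] [sQ cQ]; split=> [|i].
  apply: leq_trans (size_polyMleq _ _) _.
  by have := leq_add sP sQ; rewrite addSn addnS; case: (_ + _)%N => //= k /ltnW.
by rewrite coefM; apply: npdeg_le_sum => j _; apply: IH.
Qed.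

Lemma npdeg_le1 n e : npdeg_le e (1 : npoly n).
Proof.
elim: n => //= n IH; split=> [|i]; first by rewrite size_poly1.
by rewrite coef1; case: (i == 0)%N; [exact: IH|exact: npdeg_le0].
Qed.

Lemma npdeg_leX n a k (P : npoly n) : npdeg_le a P -> npdeg_le (k * a) (P ^+ k).
Proof.
move=> aP; elim: k => [|k IH]; first by rewrite expr0; apply: npdeg_le1.
by rewrite exprS mulSn; apply: npdeg_leM.
Qed.

Lemma npdeg_ex n (P : npoly n) : exists e, npdeg_le e P.
Proof.
elim: n P => [|n IH] P; first by exists 0.
suff [e He] : exists e, forall i, (i < size P)%N -> npdeg_le e (P`_i : npoly n).
  exists (maxn (size P) e); split=> [|i].
    by rewrite ltnW// ltnS leq_maxl.
  case: (ltnP i (size P)) => [/He|sPi]; first exact/npdeg_le_trans/leq_maxr.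
  by rewrite nth_default//; apply: npdeg_le0.
elim: (size P) => [|k [e He]]; first by exists 0.
have [e' He'] := IH (P`_k); exists (maxn e e') => i.
rewrite ltnS leq_eqVlt => /orP[/eqP->|/He].
  exact: npdeg_le_trans (leq_maxr _ _) He'.
exact/npdeg_le_trans/leq_maxl.
Qed.

Lemma npdeg_ex_seq n m (F : nat -> npoly n) :
  exists e, forall i, (i < m)%N -> npdeg_le e (F i).
Proof.
elim: m => [|m [e He]]; first by exists 0.
have [e' He'] := npdeg_ex (F m); exists (maxn e e') => i.
rewrite ltnS leq_eqVlt => /orP[/eqP->|/He].
  exact: npdeg_le_trans (leq_maxr _ _) He'.
exact/npdeg_le_trans/leq_maxl.
Qed.

(** Each of the n variables occurs with exponent at most e and is replaced by a polynomial of degree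
    at most d, hence contributes at most e * d. *)
Lemma npdeg_le_subst m n d e (F : nat -> npoly m) (P : npoly n) :
    (forall i, (i < n)%N -> npdeg_le d (F i)) -> npdeg_le e P ->
  npdeg_le (n * (e * d)) (npsubst (npconst m) F n P).
Proof.
elim: n P => [|n IH] P dF.
  move=> _ /=; elim: m {F dF} => //= m IH; split=> [|i]; first exact: size_polyC_leq1.
  by rewrite coefC; case: eqP => // _; exact: npdeg_le0.
move=> [sP cP]; rewrite npsubstS (@horner_coef_wide _ e.+1); last first.
  exact: leq_trans (size_poly _ _) sP.
apply: npdeg_le_sum => i _; rewrite coef_map mulSn addnC; apply: npdeg_leM.
  by apply: IH => [j jn|]; [apply: dF; exact: leqW|exact: cP].
apply: npdeg_le_trans (npdeg_leX i (dF _ (ltnSn n))).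
by rewrite leq_mul2r -ltnS ltn_ord orbT.
Qed.

End NestedPolynomials.

(** * Coefficient vectors and algebraic dependence *)

Section CoefficientVectors.
Variable R : numFieldType.

(** In this recursive form a vector of length [boxdim L n.+1] has by conversion the size of a matrix
    with L rows, one per power of the last variable. *)
Fixpoint boxdim (L n : nat) : nat := if n is n'.+1 then (L * boxdim L n')%N else 1%N.

Lemma boxdimE L n : boxdim L n = (L ^ n)%N.
Proof. by elim: n => //= n ->; rewrite expnS. Qed.

Fixpoint np_of_coefs (L n : nat) : 'rV[R]_(boxdim L n) -> npoly R n :=
  match n return 'rV[R]_(boxdim L n) -> npoly R n with
  | 0 => fun v => v 0 0
  | n'.+1 => fun v => \poly_(i < L) np_of_coefs
      (if insub i is Some j then row j (vec_mx v : 'M[R]_(L, boxdim L n')) else 0)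
  end.

Fixpoint np_coefs (L n : nat) : npoly R n -> 'rV[R]_(boxdim L n) :=
  match n return npoly R n -> 'rV[R]_(boxdim L n) with
  | 0 => fun c => const_mx c
  | n'.+1 => fun P : {poly npoly R n'} => mxvec (\matrix_(i < L) np_coefs L (P`_i))
  end.

Lemma np_of_coefs_linear L n a u v :
  np_of_coefs (a *: u + v) =
    npconst R n a * @np_of_coefs L n u + np_of_coefs v.
Proof.
elim: n u v => [|n IH] u v; first by rewrite /= !mxE.
apply/polyP => i /=; rewrite coefD coefCM !coef_poly.
case: ltnP => [iL|_]; last by rewrite mulr0 addr0.
by rewrite insubT /= -IH !linearP.
Qed.

Lemma np_coefs_linear L n a (P Q : npoly R n) :
  np_coefs L (npconst R n a * P + Q) = a *: np_coefs L P + np_coefs L Q.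
Proof.
elim: n P Q => [|n IH] P Q; first by apply/rowP => i; rewrite !mxE.
rewrite /= -linearP; congr mxvec; apply/row_matrixP => i.
by rewrite linearP /= !rowK coefD coefCM IH.
Qed.

Lemma np_of_coefsK L n (v : 'rV[R]_(boxdim L n)) :
  np_coefs L (np_of_coefs v) = v.
Proof.
elim: n v => [|n IH] v.
  by apply/rowP => i; rewrite mxE (ord1 i).
rewrite /= -[RHS]vec_mxK; congr mxvec; apply/row_matrixP => i.
by rewrite rowK coef_poly ltn_ord valK IH.
Qed.

Lemma np_coefs_inj L n (P : npoly R n) :
  npdeg_le L P -> np_coefs L.+1 P = 0 -> P = 0.
Proof.
elim: n P => [|n IH] P.
  by move=> _ /(congr1 (fun u : 'rV_1 => u 0 0)) /=; rewrite !mxE.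
move=> [sP cP] /= P0; apply/polyP => i; rewrite coef0.
case: (ltnP i L.+1) => iL; last by rewrite nth_default// (leq_trans sP).
apply: IH (cP i) _.
have := congr1 (fun u => row (Ordinal iL) (vec_mx u)) P0.
by rewrite mxvecK rowK => ->; rewrite !linear0.
Qed.

Lemma npdeg_le_of_coefs L n (v : 'rV[R]_(boxdim L.+1 n)) :
  npdeg_le L (np_of_coefs v).
Proof.
elim: n v => //= n IH v; split=> [|i]; first exact: size_poly.
by rewrite coef_poly; case: ltnP => _; [exact: IH|exact: npdeg_le0].
Qed.

Lemma linear_dim_ker m n (T : 'rV[R]_m -> 'rV[R]_n) :
  linear T -> (n < m)%N -> exists2 v, v != 0 & T v = 0.
Proof.
move=> linT nm.
pose T' : {linear 'rV[R]_m -> 'rV[R]_n} := HB.pack T (GRing.isLinear.Build _ _ _ _ T linT).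
have : kermx (lin1_mx T') != 0.
  rewrite -mxrank_eq0 mxrank_ker subn_eq0 -ltnNge.
  exact: leq_ltn_trans (rank_leq_col _) nm.
case/rowV0Pn => v /sub_kermxP vK v0; exists v => //.
by rewrite -[T]/(T' : _ -> _) -mul_rV_lin1.
Qed.

(** A discrete mean value inequality, controlling how the number of coefficients grows with the
    degree bound. *)
Lemma expnD_le b d m : ((b + d) ^ m <= b ^ m + d * m * (b + d) ^ m.-1)%N.
Proof.
elim: m => [|m IH]; first by rewrite !expn0 leq_addr.
rewrite /= expnS mulnDl expnS (mulnS d m) mulnDl (addnC (d * _)) addnA leq_add2r.
apply: leq_trans (leq_mul (leqnn b) IH) _; rewrite mulnDr leq_add2l.
case: m {IH} => [|m]; first by rewrite !(muln0, mul0n).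
by rewrite /= [(b * _)%N]mulnCA leq_mul2l expnS leq_mul2r leq_addr !orbT.
Qed.

(* A dimension count: with box degrees D large, the (D+1)^m unknown
   coefficients of P together with those of Q outnumber the equations. *)
Lemma algebraic_dependence_mod m (q : npoly R m) (F : nat -> npoly R m) :
    q != 0 ->
  exists P : npoly R m, P != 0 /\
    exists Q, npsubst (npconst R m) F m P = q * Q.
Proof.
move=> q0; have [e0 He0] := npdeg_ex q; have [e1 He1] := npdeg_ex_seq m F.
pose d := (e0 + e1).+1.
have dq : npdeg_le d q by apply: npdeg_le_trans He0; rewrite /d; lia.
have dF i : (i < m)%N -> npdeg_le d (F i).
  by move=> /He1; apply: npdeg_le_trans; rewrite /d; lia.
(* By [expnD_le] the equations outnumber the coefficients of Q by at most d m (d + K + 1)^(m-1). As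
   d + K + 1 <= (m d + d + 1) (D + 1), this choice of [D] bounds that by D (D + 1)^(m-1), less than
   the (D + 1)^m coefficients of P. *)
pose D := (d * m * (m * d + d + 1) ^ m.-1)%N.
pose K := (m * (D * d))%N.
pose T (v : 'rV[R]_(boxdim D.+1 m + boxdim K.+1 m)) : 'rV[R]_(boxdim (d + K).+1 m) :=
  np_coefs _ (npsubst (npconst R m) F m (np_of_coefs (lsubmx v))
    - q * np_of_coefs (rsubmx v)).
have linT : linear T.
  move=> a u v; rewrite /T -np_coefs_linear; congr np_coefs.
  rewrite !linearP/= !np_of_coefs_linear rmorphD rmorphM npsubst_const.
  ring.
have [|v v0 Tv] := linear_dim_ker linT.
  rewrite !boxdimE.
  have := expnD_le K.+1 d m; rewrite addSn (addnC K) => /leq_ltn_trans; apply.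
  rewrite addnC ltn_add2r.
  case: (posnP m) => [->|m0]; first by rewrite muln0 mul0n.
  have leDK : ((d + K).+1 <= (m * d + d + 1) * D.+1)%N.
    rewrite /K; move: (D) => D'; nia.
  apply: (@leq_ltn_trans (D * D.+1 ^ m.-1)).
    rewrite /D -[leqRHS]mulnA -expnMn -/D leq_mul2l; apply/orP; right.
    by case: m.-1 => // m'; rewrite leq_exp2r.
  by rewrite -[in ltnRHS](prednK m0) expnS ltn_mul2r ltnSn expn_gt0.
have degPQ : npdeg_le (d + K) (npsubst (npconst R m) F m (np_of_coefs (lsubmx v))
    - q * np_of_coefs (rsubmx v)).
  apply: npdeg_leD; last first.
    by apply: npdeg_leN; apply: npdeg_leM => //; apply: npdeg_le_of_coefs.
  apply: npdeg_le_trans (npdeg_le_subst dF (npdeg_le_of_coefs _)).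
  exact: leq_addl.
have /eqP := np_coefs_inj degPQ Tv; rewrite subr_eq0 => /eqP eqPQ.
exists (np_of_coefs (lsubmx v)); split; last by exists (np_of_coefs (rsubmx v)).
(* If P = 0 then q * Q = 0, so Q = 0 as well and the kernel vector v would vanish. *)
apply: contra_neq v0 => P0; rewrite -[v]hsubmxK.
have l0 := np_of_coefsK (lsubmx v); have r0 := np_of_coefsK (rsubmx v).
have /eqP : q * np_of_coefs (rsubmx v) = 0 by rewrite -eqPQ P0 rmorph0.
rewrite mulf_eq0 (negbTE q0) => /eqP Q0.
have np0 L : np_coefs L (0 : npoly R m) = 0.
  by have := np_coefs_linear L (-1) (0 : npoly R m) 0; rewrite mulr0 addr0 scaleN1r addNr.
by rewrite -l0 -r0 P0 Q0 !np0 row_mx0.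
Qed.

End CoefficientVectors.

(** * Algebraic sets, chains and images of polynomial maps *)

Section AlgebraicSets.
Variables (R : realType) (N : nat).
Local Notation V := 'rV[R]_N.

Definition polyfun (f : V -> R) : Prop :=
  exists p : mpoly N R, forall x, f x = meval (fun i => x 0 i) p.

Lemma polyfun_const c : polyfun (fun=> c).
Proof. by exists (mpolyC N c) => x; rewrite mevalC. Qed.

Lemma polyfunM f g : polyfun f -> polyfun g -> polyfun (fun x => f x * g x).
Proof. by move=> [p fE] [q gE]; exists (p * q) => x; rewrite mevalM fE gE. Qed.

Lemma polyfun_npeval n (P : npoly R n) (F : nat -> V -> R) :
  (forall i, (i < n)%N -> polyfun (F i)) ->
  polyfun (fun y => npeval (F^~ y) P).
Proof.
elim: n P => [|n IH] P polyF; first exact: polyfun_const.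
have poly_sum k (g : nat -> V -> R) : (forall i, polyfun (g i)) ->
    polyfun (fun x => \sum_(i < k) g i x).
  move=> polyg; elim: k => [|k [p pE]].
    by exists 0 => x; rewrite big_ord0 meval0.
  have [q qE] := polyg k; exists (p + q) => x.
  by rewrite big_ord_recr /= pE qE mevalD.
have poly_exp k f : polyfun f -> polyfun (fun x => f x ^+ k).
  move=> [p pE]; exists (p ^+ k) => x; rewrite pE.
  elim: k => [|k IHk]; first by rewrite !expr0 meval1.
  by rewrite !exprS mevalM -IHk.
have [p pE] := poly_sum (size P)
  (fun i y => npeval (F^~ y) (P`_i : npoly R n) * F n y ^+ i)
  (fun i => polyfunM (IH _ (fun j jn => polyF j (leqW jn)))
              (poly_exp i _ (polyF n (ltnSn n)))).
exists p => y; rewrite -pE /npeval npsubstS (@horner_coef_wide _ (size P)); last first.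
  exact: size_poly.
by apply: eq_bigr => i _; rewrite coef_map.
Qed.

Lemma algebraic_zeros (F : set (V -> R)) (Z : set V) :
  F `<=` polyfun -> (forall x, Z x <-> forall f, F f -> f x = 0) -> algebraic Z.
Proof.
move=> Fpoly ZF.
exists [set p | exists2 f, F f & forall x, f x = meval (fun i => x 0 i) p].
apply/seteqP; split=> x /=.
  by move=> /ZF Hx p [f Ff <-]; exact: Hx.
by move=> Hx; apply/ZF => f Ff; have [p pE] := Fpoly f Ff; rewrite pE; apply: Hx; exists f.
Qed.

Lemma algebraicP (Z : set V) : algebraic Z ->
  exists2 F : set (V -> R), F `<=` polyfun & Z = [set x | forall f, F f -> f x = 0].
Proof.
case=> P ->.
exists [set f | exists2 p, P p & f = fun x : V => meval (fun i => x 0 i) p].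
  by move=> f /= [p _ ->]; exists p.
apply/seteqP; split=> x /= Hx.
  by move=> f [p Pp ->]; exact: Hx.
by move=> p Pp; apply: (Hx (fun y : V => meval (fun i => y 0 i) p)); exists p.
Qed.

Lemma algebraicI (A B : set V) : algebraic A -> algebraic B -> algebraic (A `&` B).
Proof.
move=> /algebraicP[F Fp ->] /algebraicP[H Hp ->].
apply: (@algebraic_zeros (F `|` H)) => [f [/Fp|/Hp]//|x /=]; split=> [[Fx Hx] f [/Fx|/Hx]//|Hx].
by split=> f Ff; apply: Hx; [left|right].
Qed.

Lemma algebraicU (A B : set V) : algebraic A -> algebraic B -> algebraic (A `|` B).
Proof.
move=> /algebraicP[F Fp ->] /algebraicP[H Hp ->].
apply: (@algebraic_zeros [set h | exists f g, [/\ F f, H g & h = fun x => f x * g x]]).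
  by move=> h [f [g [/Fp fp /Hp gp ->]]]; exact: polyfunM.
move=> x /=; split.
  by move=> Hx h [f [g [Ff Hg ->]]]; case: Hx => Hx; rewrite ?(Hx f Ff) ?(Hx g Hg) ?mul0r ?mulr0.
move=> Hx; apply: contrapT => /not_orP[/existsNP[f /not_implyP[Ff fx]]
                              /existsNP[g /not_implyP[Hg gx]]].
have /eqP : f x * g x = 0 by apply: (Hx (fun x => f x * g x)); exists f, g.
by rewrite mulf_eq0 => /orP[] /eqP.
Qed.

Lemma algebraic_zero f : polyfun f -> algebraic [set x | f x = 0].
Proof.
move=> fp; apply: (@algebraic_zeros [set f]) => [_ ->//|x /=].
by split=> [fx _ ->//|]; exact.
Qed.

Lemma irreducible_subU (C A B : set V) : irreducible_algebraic C ->
  algebraic A -> algebraic B -> C `<=` A `|` B -> C `<=` A \/ C `<=` B.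
Proof.
move=> [Calg _ Cirr] Aalg Balg CAB.
have [] : C = C `&` A \/ C = C `&` B.
- by apply: Cirr; [exact: algebraicI|exact: algebraicI|rewrite -setIUr; apply/esym/setIidPl].
- by left; apply/setIidPl.
- by right; apply/setIidPl.
Qed.

(** The zero sets of f and g cover C, so one of them contains it: the vanishing ideal of C is
    prime. *)
Lemma irreducible_prime (C : set V) f g : irreducible_algebraic C ->
    polyfun f -> polyfun g -> (forall x, C x -> f x * g x = 0) ->
  (forall x, C x -> f x = 0) \/ (forall x, C x -> g x = 0).
Proof.
move=> Cirr fp gp fg0.
apply: (irreducible_subU Cirr (algebraic_zero fp) (algebraic_zero gp)) => x /fg0 /eqP.
by rewrite mulf_eq0 => /orP[]/eqP; [left|right].
Qed.

Lemma algebraic_separation (A B : set V) : algebraic A -> A `<` B ->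
  exists f, [/\ polyfun f, forall x, A x -> f x = 0 & exists2 x, B x & f x != 0].
Proof.
move=> /algebraicP[F Fp ->] [AB /existsNP[x /not_implyP[Bx /existsNP[f /not_implyP[Ff /eqP fx]]]]].
by exists f; split; [exact: Fp|move=> y; exact|exists x].
Qed.

(* Functions f i vanishing on C i but not on C i.+1 are algebraically
   independent along the chain: reducing a relation modulo f n on C n removes
   the last variable. *)
Lemma chain_alg_indep (C : nat -> set V) (f : nat -> V -> R) k :
    (forall i, (i <= k)%N -> irreducible_algebraic (C i)) ->
    (forall i, (i < k)%N -> C i `<=` C i.+1) ->
    (forall i, (i < k)%N -> polyfun (f i)) ->
    (forall i x, (i < k)%N -> C i x -> f i x = 0) ->
    (forall i, (i < k)%N -> exists2 x, C i.+1 x & f i x != 0) ->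
  forall P : npoly R k, P != 0 -> exists2 x, C k x & npeval (f^~ x) P != 0.
Proof.
elim: k => [|n IH] Cirr Csub fp f0 f1 P P0.
  by have [_ [x Cx] _] := Cirr 0 (leqnn 0); exists x.
have {}IH : forall P : npoly R n, P != 0 -> exists2 x, C n x & npeval (f^~ x) P != 0.
  apply: IH => [i ik|i ik|i ik|i x ik|i ik]; [exact/Cirr/leqW|exact/Csub/leqW|
    exact/fp/leqW|exact/f0/leqW|exact/f1/leqW].
suff : exists2 x, C n.+1 x & (map_poly (npsubst idfun (f^~ x) n) P).[f n x] != 0 by [].
have [m] := ubnP (size (P : {poly npoly R n})).
elim: m P P0 => // m IHm P P0 sPm.
(* On C n, where f n vanishes, only the constant coefficient in the last variable remains; if it is
   nonzero the case of n variables applies. *)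
case: (eqVneq P`_0 0) => [c0|c0]; last first.
  have [x Cx Px] := IH _ c0; exists x; first exact: Csub.
  rewrite f0// horner_coef0 coef_map; exact: Px.
(* Now P is Q times the last variable. If P vanished on C n.+1, then by primality so would f n or Q,
   and Q has smaller degree. *)
have : root P 0 by rewrite rootE horner_coef0 c0.
case/factor_theorem => Q; rewrite subr0 => PE.
have Q0 : Q != 0 by apply: contra_neq P0; rewrite PE => ->; rewrite mul0r.
have [|x Cx Qx] := IHm Q Q0.
  by move: sPm; rewrite PE size_mulX// ltnS.
apply: contrapT => noP.
case: (@irreducible_prime (C n.+1) (f n) (fun x => (map_poly (npsubst idfun (f^~ x) n) Q).[f n x])).
- exact: Cirr.
- exact: fp.
- exact: (@polyfun_npeval n.+1 Q).
- move=> y Cy; apply: contrapT => /eqP ne; apply: noP; exists y => //.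
  by rewrite PE rmorphM /= map_polyX hornerMX mulrC.
- by move=> fn0; have [y Cy] := f1 n (ltnSn n); rewrite fn0// eqxx.
- by move=> /(_ x Cx)/eqP; rewrite (negbTE Qx).
Qed.

Definition small_codim (c : nat) (S : set V) : Prop :=
  exists Z : set V, [/\ algebraic Z, codim_ge Z c & S `<=` Z].

Lemma small_codimS c (S T : set V) : S `<=` T -> small_codim c T -> small_codim c S.
Proof. by move=> ST [Z [? ? TZ]]; exists Z; split=> //; exact: subset_trans TZ. Qed.

(** The largest member of a chain in the union is irreducible, so it lies in one of the two sets,
    and the chain with it. *)
Lemma small_codimU c (S T : set V) :
  small_codim c S -> small_codim c T -> small_codim c (S `|` T).
Proof.
move=> [Z [Za Zc SZ]] [Y [Ya Yc TY]]; exists (Z `|` Y); split.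
- exact: algebraicU.
- move=> k [C [Cirr Csub CkZY]].
  have [CZ|CY] := irreducible_subU (Cirr k (leqnn k)) Za Ya CkZY.
    by apply: Zc; exists C.
  by apply: Yc; exists C.
- exact: setUSS.
Qed.

Lemma small_codim_big c (I : finType) (S : I -> set V) :
  (forall i, small_codim c (S i)) -> small_codim c [set x | exists i, S i x].
Proof.
move=> Ssmall.
suff H (s : seq I) : small_codim c [set x | exists2 i, i \in s & S i x].
  by apply: small_codimS (H (enum I)) => x [i Six]; exists i => //; rewrite mem_enum.
elim: s => [|i s IH].
  exists [set x | (1 : R) = 0]; split.
  - by have := algebraic_zero (polyfun_const 1).
  - move=> k [C [Cirr _ Csub]]; have [_ [x /Csub/= /eqP]] := Cirr k (leqnn k).
    by rewrite oner_eq0.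
  - by move=> x [].
apply: small_codimS (small_codimU (Ssmall i) IH) => x [j].
by rewrite inE => /orP[/eqP->|js] Sx; [left|right; exists j].
Qed.

(** A chain of length at least M in the closure of the image gives M functions independent along it,
    while their pullbacks by phi satisfy a relation modulo q. So chains have length at most M - 1,
    and M - 1 + c <= N. *)
Lemma small_codim_param M c (q : npoly R M) (phi : (nat -> R) -> V) :
    (M + c <= N.+1)%N -> q != 0 ->
    (forall j, exists F : npoly R M, forall x, phi x 0 j = npeval x F) ->
  small_codim c [set phi x | x in [set x | npeval x q = 0]].
Proof.
move=> McN q0 phiP; set S := (X in small_codim c X).
(* The Zariski closure of the image. *)
pose Z := [set x | forall f, polyfun f /\ (forall y, S y -> f y = 0) -> f x = 0].
exists Z; split; last by move=> x Sx f [_]; apply.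
  by apply: (@algebraic_zeros [set f | polyfun f /\ forall y, S y -> f y = 0]) => [f []|x].
move=> k [C [Cirr Csub CkZ]].
suff kM : (k < M)%N by rewrite -ltnS; apply: leq_trans McN; rewrite ltn_add2r.
rewrite ltnNge; apply/negP => Mk.
have Csub' i j : (i <= j)%N -> (j <= k)%N -> C i `<=` C j.
  elim: j => [|j IH]; first by rewrite leqn0 => /eqP-> _ x.
  rewrite leq_eqVlt => /orP[/eqP-> _ x //|]; rewrite ltnS => ij jk.
  exact: subset_trans (IH ij (ltnW jk)) (proj1 (Csub j jk)).
have /choice [f fP] i : exists f, (i < k)%N -> [/\ polyfun f, forall x, C i x -> f x = 0 &
    exists2 x, C i.+1 x & f x != 0].
  case: (ltnP i k) => ik; last by exists (fun=> 0).
  have [Calg _ _] := Cirr i (ltnW ik).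
  by have [f] := algebraic_separation Calg (Csub i ik); exists f.
have fk i : (i < M)%N -> (i < k)%N by move=> /leq_trans; apply.
have /choice [F FP] i : exists F : npoly R M, (i < M)%N -> forall x, f i (phi x) = npeval x F.
  case: (ltnP i M) => iM; last by exists 0.
  have [[p pE] _ _] := fP i (fk i iM).
  have /choice [H HE] := phiP.
  exists (mmap (npconst R M) H p) => _ x; rewrite pE.
  rewrite mevalE /npeval /mmap rmorph_sum; apply: eq_bigr => m _.
  rewrite rmorphM /= npsubst_const; congr (_ * _).
  by rewrite /mmap1 rmorph_prod; apply: eq_bigr => j _; rewrite rmorphXn /= HE.
have [P [P0 [Q PQ]]] := algebraic_dependence_mod F q0.
have [x CMx] := @chain_alg_indep C f M (fun i iM => Cirr i (leq_trans iM Mk))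
  (fun i iM => proj1 (Csub i (fk i iM)))
  (fun i iM => let: And3 a _ _ := fP i (fk i iM) in a)
  (fun i x iM => (let: And3 _ a _ := fP i (fk i iM) in a) x)
  (fun i iM => let: And3 _ _ a := fP i (fk i iM) in a) P P0.
move/eqP; apply.
(* The relation P, evaluated at the f i, pulls back to a multiple of q; so it vanishes on the image,
   on its closure, and at x. *)
have Zx : Z x by apply/CkZ/(Csub' M k).
apply: (Zx (fun y => npeval (f^~ y) P)); split.
  by apply: polyfun_npeval => i /fk /fP[].
move=> _ [t /= qt <-].
have -> : npeval (f^~ (phi t)) P = npeval t (npsubst (npconst R M) F M P).
  apply/esym/npsubst_comp => [a|i iM]; first exact: npsubst_const.
  by rewrite FP.
by rewrite PQ /npeval rmorphM /= [npsubst _ _ _ q]qt mul0r.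
Qed.

End AlgebraicSets.

(** * Linear forms on R^N *)

Section LinearForms.
Variables (R : realType) (N : nat).
Local Notation g := 'rV[R]_N.

Definition dot (lam x : g) : R := \sum_i lam 0 i * x 0 i.

Lemma dot_linear lam : linear (dot lam : g -> R^o).
Proof.
move=> a x y; rewrite /dot scaler_sumr -big_split; apply: eq_bigr => i _.
by rewrite !mxE mulrDr mulrCA.
Qed.

HB.instance Definition _ lam :=
  GRing.isLinear.Build R g R^o *:%R (dot lam) (@dot_linear lam).

Lemma dotD lam x y : dot lam (x + y) = dot lam x + dot lam y.
Proof. exact: (linearD (dot lam)). Qed.

Lemma dotN lam x : dot lam (- x) = - dot lam x.
Proof. exact: (linearN (dot lam)). Qed.

Lemma dotB lam x y : dot lam (x - y) = dot lam x - dot lam y.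
Proof. exact: (linearB (dot lam)). Qed.

Lemma dotZ lam a x : dot lam (a *: x) = a * dot lam x.
Proof. exact: (linearZ_LR (dot lam)). Qed.

Lemma dot0 lam : dot lam 0 = 0.
Proof. exact: (linear0 (dot lam)). Qed.

Lemma dot_sum lam I (r : seq I) (P : pred I) (F : I -> g) :
  dot lam (\sum_(i <- r | P i) F i) = \sum_(i <- r | P i) dot lam (F i).
Proof. exact: (linear_sum (dot lam)). Qed.

Lemma dotZl a lam x : dot (a *: lam) x = a * dot lam x.
Proof. by rewrite /dot mulr_sumr; apply: eq_bigr => i _; rewrite mxE mulrA. Qed.

Lemma dot_delta i x : dot (delta_mx 0 i) x = x 0 i.
Proof.
rewrite /dot (bigD1 i)//= mxE !eqxx mul1r big1 ?addr0// => j ji.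
by rewrite mxE eqxx (negbTE ji) mul0r.
Qed.

(** A coordinate of x - projv U x that does not vanish at p. *)
Lemma separating_form (U : {vspace g}) (p : g) : p \notin U ->
  exists mu, (forall x, x \in U -> dot mu x = 0) /\ dot mu p != 0.
Proof.
move=> pU; have : p - projv U p != 0.
  by apply: contraNneq pU => /subr0_eq ->; exact: memv_proj.
case/rV0Pn => i pi0.
exists (\row_j ((delta_mx 0 j : g) - projv U (delta_mx 0 j)) 0 i).
have dotE x : dot (\row_j ((delta_mx 0 j : g) - projv U (delta_mx 0 j)) 0 i) x =
    (x - projv U x) 0 i.
  rewrite [in RHS](row_sum_delta x) linear_sum -sumrB summxE /dot.
  by apply: eq_bigr => j _; rewrite linearZ /= !mxE eqxx /=; ring.
split=> [x xU|]; first by rewrite dotE projv_id// subrr mxE.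
by rewrite dotE.
Qed.

End LinearForms.

(** * Skew forms, Pfaffians and the kernel W *)

Section AbnormalPoints.
Variables (R : realType) (N : nat) (G : carnot2 R N).
Local Notation g := 'rV[R]_N.

Lemma lie_suml I (r : seq I) (P : pred I) (F : I -> g) z :
  lie G (\sum_(i <- r | P i) F i) z = \sum_(i <- r | P i) lie G (F i) z.
Proof. by elim/big_rec2: _ => [|i a b _ <-]; rewrite ?lie0l ?lieDl. Qed.

Lemma lie_sumr I (r : seq I) (P : pred I) (F : I -> g) z :
  lie G z (\sum_(i <- r | P i) F i) = \sum_(i <- r | P i) lie G z (F i).
Proof. by elim/big_rec2: _ => [|i a b _ <-]; rewrite ?lie0r ?lieDr. Qed.

Lemma lie_V1_V2 x y : x \in V1 G -> y \in V1 G -> lie G x y \in V2 G.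
Proof. by move=> xV yV; rewrite V2_def; exact: mem_bracket_space. Qed.

Definition form_kernel (lam : g) : set g :=
  [set w | w \in V1 G /\ forall y, y \in V1 G -> dot lam (lie G w y) = 0].

(* p lies in the subgroup W + [W, W], where W is the kernel in V1 of the skew
   form lam [., .]; membership is tested against the linear forms. *)
Definition abnormal_point (lam p : g) : Prop :=
  [/\ lam != 0, forall x, x \in V1 G -> dot lam x = 0
    & forall mu, (forall w, form_kernel lam w -> dot mu w = 0) ->
        (forall w w', form_kernel lam w -> form_kernel lam w' ->
          dot mu (lie G w w') = 0) -> dot mu p = 0].

Lemma abnormal_pointZ a lam p : a != 0 ->
  abnormal_point lam p -> abnormal_point (a *: lam) p.
Proof.
move=> a0 [l0 l1 lp]; split; first by rewrite scaler_eq0 negb_or a0.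
  by move=> x /l1; rewrite dotZl => ->; rewrite mulr0.
have sub w : form_kernel lam w -> form_kernel (a *: lam) w.
  by move=> [wV ww]; split=> // y /ww; rewrite dotZl => ->; rewrite mulr0.
by move=> mu H1 H2; apply: lp => [w /sub/H1|w w' /sub + /sub]; [|exact: H2].
Qed.

Local Notation n := (\dim (V1 G)).
Local Notation s := (\dim (V2 G)).
Local Notation e i := ((vbasis (V1 G))`_(i : 'I_n)).
Local Notation f a := ((vbasis (V2 G))`_(a : 'I_s)).

Lemma eV1 (i : 'I_n) : e i \in V1 G.
Proof. by rewrite vbasis_mem// mem_nth// size_tuple. Qed.

Lemma fV2 (a : 'I_s) : f a \in V2 G.
Proof. by rewrite vbasis_mem// mem_nth// size_tuple. Qed.

Lemma dim_layers : (n + s = N)%N.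
Proof.
have := directvP (V12_direct G); rewrite /= V12_full dimvf => /esym dimE.
by apply: etrans dimE _; rewrite /dim /= mul1n.
Qed.

Definition struct_const (a : 'I_s) (i j : 'I_n) : R :=
  coord (vbasis (V2 G)) a (lie G (e i) (e j)).
Local Notation C := struct_const.

(** The form enters only through its values l on the basis of V2, and the entries are linear in
    l. *)
Definition skew_form (l : 'I_s -> R) (i j : 'I_n) : R := \sum_a l a * C a i j.
Local Notation om := skew_form.

Lemma lie_ee i j : lie G (e i) (e j) = \sum_a C a i j *: f a.
Proof. exact: coord_vbasis (lie_V1_V2 (eV1 i) (eV1 j)). Qed.

Lemma struct_constC a i j : C a i j = - C a j i.
Proof. by rewrite /C lie_antisym linearN. Qed.

Lemma struct_constxx a i : C a i i = 0.
Proof. by rewrite /C liexx linear0. Qed.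

Lemma skew_formC l i j : om l i j = - om l j i.
Proof. by rewrite /om -sumrN; apply: eq_bigr => a _; rewrite struct_constC mulrN. Qed.

Lemma skew_formxx l i : om l i i = 0.
Proof. by rewrite /om big1// => a _; rewrite struct_constxx mulr0. Qed.

Lemma dot_lie_ee lam i j : dot lam (lie G (e i) (e j)) = om (fun a => dot lam (f a)) i j.
Proof.
by rewrite lie_ee dot_sum; apply: eq_bigr => a _; rewrite dotZ mulrC.
Qed.

Definition pfaffian4 (l : 'I_s -> R) (i j k m : 'I_n) : R :=
  om l i j * om l k m - om l i k * om l j m + om l i m * om l j k.

(* These vectors are orthogonal to e i and e j for the skew form; where
   om l i j != 0 they span the orthogonal complement of that pair. *)
Definition orth_vec l (i j m : 'I_n) : g :=
  om l i j *: e m - om l i m *: e j + om l j m *: e i.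
Local Notation E := orth_vec.

Lemma orth_vec_self1 l i j : E l i j i = 0.
Proof. by rewrite /E skew_formxx scale0r subr0 (skew_formC l j i) scaleNr subrr. Qed.

Lemma orth_vec_self2 l i j : E l i j j = 0.
Proof. by rewrite /E skew_formxx scale0r addr0 subrr. Qed.

(** For w expanded along the [orth_vec], the condition lam [w, e r] = 0 thus becomes a linear
    equation with Pfaffian coefficients. *)
Lemma dot_lie_orth_vec lam i j m r :
  let l := fun a => dot lam (f a) in
  dot lam (lie G (E l i j m) (e r)) = - pfaffian4 l i j r m.
Proof.
move=> l; rewrite /E !lieDl -scaleNr !lieZl !dotD !dotZ !dot_lie_ee -/l /pfaffian4.
by rewrite (skew_formC l m r); ring.
Qed.

(** The factor in parentheses is the derivative of the Pfaffian of i, j, m, m' with respect to l a: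
    the bracket is controlled by the Pfaffian and its polarization. *)
Lemma coord_lie_orth_vec l i j m m' a :
  coord (vbasis (V2 G)) a (lie G (E l i j m) (E l i j m')) =
  om l i j * (om l i j * C a m m' + C a i j * om l m m' - om l i m * C a j m'
     - C a i m * om l j m' + om l i m' * C a j m + C a i m' * om l j m)
  - C a i j * pfaffian4 l i j m m'.
Proof.
rewrite /E -!scaleNr !(lieDl, lieDr, lieZl, lieZr, linearD) !linearZ /=.
rewrite -!/(C _ _ _) !struct_constxx (struct_constC a m j) (struct_constC a m i).
by rewrite (struct_constC a j i) /pfaffian4 /GRing.scale /=; ring.
Qed.

(** The coordinates of w divided by [om l i j] serve as coefficients, since the extra multiples of e
    i and e j cancel by lam [w, e i] = lam [w, e j] = 0. Those at i and j can be set to 0 because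
    [orth_vec] vanishes there, which saves two parameters. *)
Lemma form_kernel_expand lam i j w :
    let l := fun a => dot lam (f a) in
    om l i j != 0 -> form_kernel lam w ->
  exists x, [/\ x i = 0, x j = 0 & w = \sum_m x m *: E l i j m].
Proof.
move=> l om0 [wV ww].
have ij : i != j by apply: contra_neq om0 => ->; rewrite skew_formxx.
pose c m := coord (vbasis (V1 G)) m w.
have wE : w = \sum_m c m *: e m by exact: coord_vbasis.
have orth r : \sum_m c m * om l m r = 0.
  rewrite -[RHS](ww _ (eV1 r)) [in RHS]wE lie_suml dot_sum.
  by apply: eq_bigr => m _; rewrite lieZl dotZ dot_lie_ee.
exists (fun m => if (m == i) || (m == j) then 0 else c m / om l i j).
rewrite !eqxx orbT; split=> //.
transitivity (\sum_m (c m / om l i j) *: E l i j m); last first.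
  apply: eq_bigr => m _; case: ifP => // /orP[]/eqP->.
    by rewrite orth_vec_self1 !scaler0.
  by rewrite orth_vec_self2 !scaler0.
have := orth i; have := orth j; rewrite {orth ww}.
have -> : \sum_m c m / om l i j *: E l i j m = \sum_m c m *: e m -
   (om l i j)^-1 *: ((\sum_m c m * om l i m) *: e j - (\sum_m c m * om l j m) *: e i).
  rewrite !scaler_suml -sumrB scaler_sumr -sumrB; apply: eq_bigr => m _.
  rewrite /E scalerDr !scalerBr !scalerA divfK// opprB addrA.
  by rewrite addrAC -!mulrA ![c m * (_ * _)]mulrCA.
move=> oj oi.
have -> : \sum_m c m * om l i m = 0.
  by rewrite -[RHS]oppr0 -[in RHS]oi -[RHS]sumrN; apply: eq_bigr => m _; rewrite skew_formC mulrN.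
have -> : \sum_m c m * om l j m = 0.
  by rewrite -[RHS]oppr0 -[in RHS]oj -[RHS]sumrN; apply: eq_bigr => m _; rewrite skew_formC mulrN.
by rewrite !scale0r subrr scaler0 subr0.
Qed.

End AbnormalPoints.

(** * Polynomial functions of the parameters *)

Section PolynomialParameters.
Variables (R : realType) (M : nat).

Definition npolyfun (h : (nat -> R) -> R) : Prop :=
  exists F : npoly R M, forall x, h x = npeval x F.

Lemma npolyfun_const c : npolyfun (fun=> c).
Proof. by exists (npconst R M c) => x; rewrite /npeval npsubst_const. Qed.

Lemma npolyfun_var i : (i < M)%N -> npolyfun (fun x => x i).
Proof. by move=> iM; exists (npvar R M i) => x; rewrite /npeval npsubst_var. Qed.

Lemma npolyfunD h k : npolyfun h -> npolyfun k -> npolyfun (fun x => h x + k x).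
Proof. by move=> [F hE] [H kE]; exists (F + H) => x; rewrite /npeval rmorphD hE kE. Qed.

Lemma npolyfunM h k : npolyfun h -> npolyfun k -> npolyfun (fun x => h x * k x).
Proof. by move=> [F hE] [H kE]; exists (F * H) => x; rewrite /npeval rmorphM hE kE. Qed.

Lemma npolyfunN h : npolyfun h -> npolyfun (fun x => - h x).
Proof. by move=> [F hE]; exists (- F) => x; rewrite /npeval rmorphN hE. Qed.

Lemma npolyfun_sum (I : finType) (h : I -> (nat -> R) -> R) :
  (forall i, npolyfun (h i)) -> npolyfun (fun x => \sum_i h i x).
Proof.
move=> /choice[F hE]; exists (\sum_i F i) => x.
by rewrite /npeval rmorph_sum; apply: eq_bigr => i _; rewrite hE.
Qed.

End PolynomialParameters.

(** * Polarization of the Pfaffian and decomposition of abnormal points *)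

Section SmallCodimension.
Variables (R : realType) (N : nat) (G : carnot2 R N).
Local Notation g := 'rV[R]_N.
Local Notation n := (\dim (V1 G)).
Local Notation s := (\dim (V2 G)).
Local Notation e i := ((vbasis (V1 G))`_(i : 'I_n)).
Local Notation f a := ((vbasis (V2 G))`_(a : 'I_s)).
Local Notation C := (@struct_const R N G).
Local Notation om := (@skew_form R N G).
Local Notation E := (@orth_vec R N G).
Local Notation values lam := (fun a : 'I_s => dot lam (f a)).

(** The values move towards the a-th dual basis vector; subtracting kappa * l preserves the
    normalization l k = 1 for the kappa used below. *)
Lemma skew_form_perturb l a (kappa sigma : R) u v :
  om (fun b => l b + sigma * ((b == a)%:R - kappa * l b)) u v =
  om l u v + sigma * (C a u v - kappa * om l u v).
Proof.
rewrite /skew_form; under eq_bigr do rewrite mulrDl.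
rewrite big_split /=; congr (_ + _).
under eq_bigr do rewrite -mulrA mulrBl -mulrA.
rewrite -mulr_sumr sumrB -mulr_sumr; congr (_ * (_ - _)).
rewrite (bigD1 a)//= eqxx mul1r big1 ?addr0// => b ba.
by rewrite (negbTE ba) mul0r.
Qed.

(* If the Pfaffian vanishes for every form, then so does its polarization. *)
Lemma lie_orth_vec_eq0 k i j :
    (forall l r m, l k = 1 -> pfaffian4 (G := G) l i j r m = 0) ->
  forall l m m', l k = 1 -> lie G (E l i j m) (E l i j m') = 0.
Proof.
move=> pf0 l m m' lk1.
have EV1 r : E l i j r \in V1 G.
  by rewrite /E; apply: rpredD; first apply: rpredB; apply: rpredZ; exact: eV1.
rewrite [LHS](coord_vbasis (lie_V1_V2 (EV1 m) (EV1 m'))) big1// => a _.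
rewrite coord_lie_orth_vec; set rhs := (X in X *: _); suff -> : rhs = 0 by rewrite scale0r.
pose kappa : R := (k == a)%:R.
pose lp sigma := fun b => l b + sigma * ((b == a)%:R - kappa * l b).
have lpk sigma : lp sigma k = 1 by rewrite /lp lk1 mulr1 /kappa subrr mulr0 addr0.
(* The Pfaffian is quadratic in sigma along [lp], so the central difference between 1 and -1 is its
   exact derivative at 0; the term 2 * kappa corrects for the component along l by Euler's
   identity. *)
transitivity (om l i j * ((pfaffian4 (lp 1) i j m m' - pfaffian4 (lp (-1)) i j m m') / 2
   + 2 * kappa * pfaffian4 l i j m m') - C a i j * pfaffian4 l i j m m').
  by rewrite /rhs /pfaffian4 /lp !skew_form_perturb; field.
by rewrite !pf0//; ring.
Qed.

Lemma dot_span_eq0 lam (X : seq g) : (forall x, x \in X -> dot lam x = 0) ->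
  forall x, x \in <<X>>%VS -> dot lam x = 0.
Proof.
move=> X0 x /(@coord_span _ _ _ (in_tuple X)) ->.
by rewrite dot_sum big1// => i _; rewrite dotZ X0 ?mulr0// mem_nth.
Qed.

Lemma abnormal_point_index lam p : abnormal_point G lam p ->
  exists k, dot lam (f k) != 0.
Proof.
move=> [lam0 lamV1 _]; apply: contrapT => nok.
have V20 x : x \in V2 G -> dot lam x = 0.
  move=> /coord_vbasis ->; rewrite dot_sum big1// => a _; rewrite dotZ.
  have /negP := (fun H => nok (ex_intro _ a H)); rewrite negbK => /eqP ->.
  by rewrite mulr0.
case/eqP: lam0; apply/rowP => i; rewrite mxE.
have : delta_mx 0 i \in (V1 G + V2 G)%VS by rewrite V12_full memvf.
case/memv_addP => v vV1 [w wV2 dE].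
have : dot lam (delta_mx 0 i) = 0 by rewrite dE dotD lamV1// V20// addr0.
rewrite /dot (bigD1 i)//= mxE !eqxx mulr1 big1 ?addr0// => j ji.
by rewrite mxE eqxx (negbTE ji) mulr0.
Qed.

Lemma skew_form_index lam k : dot lam (f k) != 0 ->
  exists i j, om (values lam) i j != 0.
Proof.
move=> lk; apply: contrapT => noij; case/eqP: lk.
move: (f k) (fV2 k) => fk; rewrite V2_def; apply: dot_span_eq0 => x.
case/allpairsP => -[u v] /= [uV vV ->].
have idx (w : g) : w \in vbasis (V1 G) -> exists i : 'I_n, w = e i.
  move=> wV; have iw : (index w (vbasis (V1 G)) < n)%N by rewrite -index_mem size_tuple in wV *.
  by exists (Ordinal iw); rewrite nth_index.
have [i ->] := idx u uV; have [j ->] := idx v vV.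
rewrite dot_lie_ee; apply/eqP; apply/negPn/negP => H; apply: noij.
by exists i, j.
Qed.

(** Were p outside W + <[z]>, a form separating it would kill W and [W, W] but not p, against
    [abnormal_point]. *)
Lemma abnormal_point_decomp lam p z : abnormal_point G lam p ->
    (forall w w', form_kernel G lam w -> form_kernel G lam w' -> lie G w w' \in <[z]>%VS) ->
  exists w t, form_kernel G lam w /\ p = w + t *: z.
Proof.
move=> [_ _ pP] zP.
pose psi (x : g) : 'rV[R]_n := \row_j dot lam (lie G x (e j)).
have lpsi : linear psi.
  by move=> a x y; apply/rowP => j; rewrite !mxE lieDl lieZl dotD dotZ.
pose psi' : {linear g -> 'rV[R]_n} := HB.pack psi (GRing.isLinear.Build _ _ _ _ psi lpsi).
pose W := (V1 G :&: lker (linfun psi'))%VS.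
have WP w : reflect (form_kernel G lam w) (w \in W).
  rewrite memv_cap memv_ker lfunE /=; apply: (iffP andP) => -[wV ww]; split=> //.
    move=> y /coord_vbasis ->; rewrite lie_sumr dot_sum big1// => j _.
    move/eqP/rowP/(_ j): ww; rewrite !mxE lieZr dotZ => ->; exact: mulr0.
  by apply/eqP/rowP => j; rewrite !mxE ww// eV1.
have [|pW] := boolP (p \in (W + <[z]>)%VS).
  by case/memv_addP => w /WP wW [_ /vlineP[t ->] ->]; exists w, t.
have [mu [mu0]] := separating_form pW; rewrite pP ?eqxx//.
  move=> w /WP wW; apply: mu0; exact: subvP (addvSl _ _) _ wW.
move=> w w' ww ww'; apply: mu0; exact: subvP (addvSr _ _) _ (zP _ _ ww ww').
Qed.

End SmallCodimension.

Lemma card_le2_cases (T : finType) (A : {pred T}) (t0 : T) : (#|A| <= 2)%N ->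
  exists a b, forall x, x \in A -> x = a \/ x = b.
Proof.
rewrite cardE => sA; exists (nth t0 (enum A) 0), (nth t0 (enum A) 1) => x.
rewrite -mem_enum; case: (enum A) sA => [|a [|b [|]]]//= _; rewrite !inE.
  by move=> /eqP; left.
by case/orP => /eqP; [left|right].
Qed.

(** * A chart of abnormal points with N - 2 parameters *)

Section Chart.
Variables (R : realType) (N : nat) (G : carnot2 R N).
Local Notation g := 'rV[R]_N.
Local Notation n := (\dim (V1 G)).
Local Notation s := (\dim (V2 G)).
Local Notation e i := ((vbasis (V1 G))`_(i : 'I_n)).
Local Notation f a := ((vbasis (V2 G))`_(a : 'I_s)).
Local Notation C := (@struct_const R N G).
Local Notation om := (@skew_form R N G).
Local Notation E := (@orth_vec R N G).
Local Notation values lam := (fun a : 'I_s => dot lam (f a)).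

Variables (k : 'I_s) (i j : 'I_n).
Hypothesis ij : i != j.

(** The values of lam on the basis of V2, the coefficients of w along the [orth_vec], and the
    coefficient on the line containing [W, W]. *)
Definition param_index : finType := ('I_s + 'I_n + unit)%type.

(** The value of lam at f k is normalized to 1; the coefficients at i and j are 0. *)
Definition fixed_param : pred param_index :=
  [pred a | a \in [:: inl (inl k); inl (inr i); inl (inr j)]].

Definition free_params : seq param_index := [seq a <- enum param_index | ~~ fixed_param a].

Lemma size_free_params : (size free_params + 3 = N.+1)%N.
Proof.
have dimE := dim_layers G.
have := count_predC fixed_param (enum param_index).
rewrite -cardE !card_sum !card_ord card_unit /free_params size_filter.
suff -> : count fixed_param (enum param_index) = 3 by move: (count _ _) => c; lia.
transitivity #|fixed_param|; first by rewrite cardE -size_filter enumT.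
rewrite (eq_card (B := mem [:: inl (inl k); inl (inr i); inl (inr j)])) => [|x]; last by rewrite !inE.
suff /card_uniqP -> : uniq [:: inl (inl k); inl (inr i); inl (inr j) : param_index] by [].
rewrite /= !inE /= !andbT; apply/negP => /eqP[] /eqP.
by rewrite (negbTE ij).
Qed.

Local Notation M := (size free_params).

Definition param_values (x : nat -> R) (a : param_index) : R :=
  if a == inl (inl k) then 1 else if fixed_param a then 0 else x (index a free_params).

Lemma npolyfun_param_values a : npolyfun M (fun x => param_values x a).
Proof.
rewrite /param_values; case: (a == _); first exact: npolyfun_const.
case fa: (fixed_param a); first exact: npolyfun_const.
by apply: npolyfun_var; rewrite index_mem mem_filter fa mem_enum.
Qed.

Lemma param_valuesP (y : param_index -> R) :
    y (inl (inl k)) = 1 -> y (inl (inr i)) = 0 -> y (inl (inr j)) = 0 ->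
  exists x, forall a, param_values x a = y a.
Proof.
move=> yk yi yj; exists (fun m => y (nth (inr tt) free_params m)) => a.
rewrite /param_values; case: eqP => [->//|ak].
case: ifPn => [|fa].
  by rewrite /fixed_param /= !inE => /or3P[/eqP/ak|/eqP->|/eqP->].
by rewrite nth_index// mem_filter fa mem_enum.
Qed.

Lemma npolyfun_skew_form (l : 'I_s -> (nat -> R) -> R) u v :
  (forall a, npolyfun M (l a)) -> npolyfun M (fun x => om (l^~ x) u v).
Proof.
by move=> lp; apply: npolyfun_sum => a; apply: npolyfunM => //; apply: npolyfun_const.
Qed.

Lemma npolyfun_pfaffian4 (l : 'I_s -> (nat -> R) -> R) r m :
  (forall a, npolyfun M (l a)) -> npolyfun M (fun x => pfaffian4 (G := G) (l^~ x) i j r m).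
Proof.
move=> lp; rewrite /pfaffian4; apply: npolyfunD; [apply: npolyfunD|];
  [|apply: npolyfunN|]; by apply: npolyfunM; exact: npolyfun_skew_form.
Qed.

Lemma npolyfun_orth_vec (l : 'I_s -> (nat -> R) -> R) m c :
  (forall a, npolyfun M (l a)) -> npolyfun M (fun x => E (l^~ x) i j m 0 c).
Proof.
move=> lp; have [F FE] : npolyfun M (fun x => om (l^~ x) i j * e m 0 c
    + - (om (l^~ x) i m * e j 0 c) + om (l^~ x) j m * e i 0 c).
  apply: npolyfunD; [apply: npolyfunD|]; [|apply: npolyfunN|];
  by apply: npolyfunM; [exact: npolyfun_skew_form|exact: npolyfun_const].
by exists F => x; rewrite -FE /E !mxE.
Qed.

Definition chart_forms (lam : g) : Prop := dot lam (f k) = 1 /\ om (values lam) i j != 0.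

(* For s <= 2 the derived subspace of the kernel lies in the at most one
   dimensional kernel of lam in V2; otherwise n <= 4, and it is spanned by the
   bracket of the only two vectors E m that are not zero. *)
Lemma derived_direction : (N <= 7)%N ->
  exists zeta : ('I_s -> R) -> g,
    (forall (l : 'I_s -> (nat -> R) -> R) c, (forall a, npolyfun M (l a)) ->
       npolyfun M (fun x => zeta (l^~ x) 0 c)) /\
    forall lam w w', chart_forms lam -> form_kernel G lam w -> form_kernel G lam w' ->
      lie G w w' \in <[zeta (values lam)]>%VS.
Proof.
move=> N7; have [s2|s3] := leqP s 2.
  have [k' Hk] : exists k', forall a, a = k \/ a = k'.
    have [] := @card_le2_cases 'I_s predT k; first by rewrite card_ord.
    move=> a [b ab]; have [->|->] := ab k isT; [exists b|exists a] => c.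
      by have [->|->] := ab c isT; [left|right].
    by have [->|->] := ab c isT; [right|left].
  have sum2 (F : 'I_s -> g) : \sum_a F a = F k + (if k' == k then 0 else F k').
    rewrite (bigD1 k)//=; congr (_ + _); case: eqP => [k'k|/eqP k'k].
      by rewrite big1// => a; have [->|->] := Hk a; rewrite ?k'k eqxx.
    rewrite (bigD1 k')//= big1 ?addr0// => a /andP[ak ak'].
    by have [aE|aE] := Hk a; rewrite aE eqxx in ak ak'.
  (* Since lam (f k) = 1, this vector spans the kernel of lam in V2; it is 0 if k' = k. *)
  exists (fun l => f k' - l k' *: f k); split=> [l c lp|lam w w' [lk1 _] wK w'K].
    have [F FE] : npolyfun M (fun x => f k' 0 c + - (l k' x * f k 0 c)).
      apply: npolyfunD; first exact: npolyfun_const.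
      by apply/npolyfunN/npolyfunM => //; exact: npolyfun_const.
    by exists F => x; rewrite -FE !mxE.
  have zV2 : lie G w w' \in V2 G by apply: lie_V1_V2; [case: wK|case: w'K].
  have z0 : dot lam (lie G w w') = 0 by case: wK w'K => _ H [/H].
  pose c a := coord (vbasis (V2 G)) a (lie G w w').
  have zE : lie G w w' = \sum_a c a *: f a := coord_vbasis zV2.
  apply/vlineP; exists (c k'); move: z0; rewrite zE sum2.
  case: (eqVneq k' k) => [->|k'k]; rewrite ?addr0 ?dotD !dotZ lk1 mulr1.
    by move=> ->; rewrite scale1r subrr scaler0 scale0r.
  by move=> /eqP; rewrite addr_eq0 => /eqP ->; rewrite scaleNr scalerBr scalerA addrC.
have n4 : (n <= 4)%N.
  move: (\dim (V1 G)) (\dim (V2 G)) (dim_layers G) s3 N7 => a b; lia.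
(* As n <= 4, at most two indices differ from i and j. *)
have [|l0 [m0 lm]] := @card_le2_cases _ [predC [:: i; j]] i.
  have /card_uniqP c2 : uniq [:: i; j] by rewrite /= inE ij.
  have := cardC (mem [:: i; j]); rewrite card_ord c2 /= => cE.
  by rewrite -(leq_add2l 2) cE.
pose Z l := lie G (E l i j l0) (E l i j m0).
exists Z; split=> [l c lp|lam w w' [lk1 om0] wK w'K].
  have EV1 x m : E (l^~ x) i j m \in V1 G.
    by rewrite /E; apply: rpredD; first apply: rpredB; apply: rpredZ; exact: eV1.
  have [F FE] : npolyfun M (fun x => \sum_a
      (coord (vbasis (V2 G)) a (Z (l^~ x)) * f a 0 c)).
    apply: npolyfun_sum => a; apply: npolyfunM; last exact: npolyfun_const.
    have omp := npolyfun_skew_form; have cp := @npolyfun_const R M.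
    have [F FE] : npolyfun M (fun x => om (l^~ x) i j *
       (om (l^~ x) i j * C a l0 m0 + C a i j * om (l^~ x) l0 m0
        + - (om (l^~ x) i l0 * C a j m0) + - (C a i l0 * om (l^~ x) j m0)
        + om (l^~ x) i m0 * C a j l0 + C a i m0 * om (l^~ x) j l0)
       + - (C a i j * pfaffian4 (G := G) (l^~ x) i j l0 m0)).
      repeat (apply: npolyfunN || apply: npolyfunD || apply: npolyfun_const ||
        (apply: npolyfun_pfaffian4; exact: lp) || (apply: npolyfun_skew_form; exact: lp) ||
        apply: npolyfunM).
    by exists F => x; rewrite -FE coord_lie_orth_vec.
  exists F => x; rewrite -FE /Z {1}(coord_vbasis (lie_V1_V2 (EV1 x l0) (EV1 x m0))).
  by rewrite summxE; apply: eq_bigr => a _; rewrite mxE.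
have [x [_ _ ->]] := form_kernel_expand om0 wK.
have [x' [_ _ ->]] := form_kernel_expand om0 w'K.
rewrite lie_suml; apply: rpred_sum => m _; rewrite lie_sumr; apply: rpred_sum => m' _.
rewrite lieZl lieZr; do 2 apply: rpredZ.
have [] := boolP (m \in [:: i; j]).
  rewrite !inE => /orP[]/eqP->; rewrite ?orth_vec_self1 ?orth_vec_self2 lie0l; exact: mem0v.
have [] := boolP (m' \in [:: i; j]).
  rewrite !inE => /orP[]/eqP-> _; rewrite ?orth_vec_self1 ?orth_vec_self2 lie0r; exact: mem0v.
move=> /lm Hm' /lm Hm.
case: Hm => ->; case: Hm' => ->; rewrite ?liexx ?mem0v//; first exact: memv_line.
by rewrite lie_antisym memvN memv_line.
Qed.

(** The N - 2 parameters of phi account for codimension two; the third comes from a nontrivial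
    polynomial equation q on them. *)
Lemma small_codim_chart : (N <= 7)%N ->
  small_codim 3 [set p | exists2 lam, chart_forms lam & abnormal_point G lam p].
Proof.
move=> N7; have [zeta [zeta_poly zetaP]] := derived_direction N7.
pose lx x a := param_values x (inl (inl a)).
pose wx x m := param_values x (inl (inr m)).
pose tx x := param_values x (inr tt).
pose phi x : g := \sum_m wx x m *: E (lx x) i j m + tx x *: zeta (lx x).
suff [q [q_poly [x0 q0] qP]] : exists q : (nat -> R) -> R,
  [/\ npolyfun M q, exists x, q x != 0 &
    forall p lam, chart_forms lam -> abnormal_point G lam p -> exists2 x, q x = 0 & p = phi x].
  have [F qE] := q_poly.
  apply: (small_codimS (T := [set phi x | x in [set x | npeval x F = 0]])).
    move=> p [lam lamk lamp]; have [x qx ->] := qP p lam lamk lamp.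
    by exists x => //=; rewrite -qE.
  apply: small_codim_param.
  - by rewrite size_free_params.
  - by apply: contra_neq q0 => F0; rewrite qE F0 /npeval rmorph0.
  - move=> c; have [H HE] : npolyfun M (fun x => \sum_m wx x m * E (lx x) i j m 0 c
        + tx x * zeta (lx x) 0 c).
      apply: npolyfunD; [apply: npolyfun_sum => m|]; apply: npolyfunM;
        try exact: npolyfun_param_values.
        by apply: (npolyfun_orth_vec (l := fun a x => lx x a)) => a; exact: npolyfun_param_values.
      by apply: (zeta_poly (fun a x => lx x a)) => a; exact: npolyfun_param_values.
    exists H => x; rewrite -HE !mxE summxE; congr (_ + _).
    by apply: eq_bigr => m _; rewrite mxE.
have param_phi lam w t : chart_forms lam -> form_kernel G lam w ->
    exists2 x, [/\ lx x = values lam, tx x = t & w = \sum_m wx x m *: E (values lam) i j m] &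
      w + t *: zeta (values lam) = phi x.
  move=> [lk1 om0] wK; have [y [yi yj wE]] := form_kernel_expand om0 wK.
  pose v (a : param_index) := match a with
    | inl (inl a) => dot lam (f a) | inl (inr m) => y m | inr _ => t end.
  have [x xv] := @param_valuesP v lk1 yi yj.
  have lxE : lx x = values lam by apply: funext => a; rewrite /lx xv.
  have wE' : w = \sum_m wx x m *: E (values lam) i j m.
    by rewrite wE; apply: eq_bigr => m _; rewrite /wx xv.
  exists x; first by split=> //; rewrite /tx xv.
  by rewrite /phi lxE -wE' /tx xv.
have [[r [m [l [lk1 pf]]]]|nopf] := pselect (exists r m l, l k = 1 /\ pfaffian4 (G := G) l i j r m != 0).
  (* [q] is the equation lam [w, e r] = 0 in the parameters. *)
  exists (fun x => \sum_m wx x m * - pfaffian4 (G := G) (lx x) i j r m); split.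
  - apply: npolyfun_sum => m'; apply: npolyfunM; first exact: npolyfun_param_values.
    apply: npolyfunN; apply: (npolyfun_pfaffian4 (l := fun a x => lx x a)) => a.
    exact: npolyfun_param_values.
  (* A Pfaffian with a repeated index vanishes, so the coefficient at m is a free parameter; at the
     values l, taking it to be 1 and the others 0 makes q nonzero. *)
  - have mi : m != i.
      by apply: contra_neq pf => ->; rewrite /pfaffian4 skew_formxx (skew_formC _ r i) (skew_formC _ j i); ring.
    have mj : m != j.
      by apply: contra_neq pf => ->; rewrite /pfaffian4 skew_formxx (skew_formC _ r j); ring.
    pose v (a : param_index) := match a with
      | inl (inl a) => l a | inl (inr m') => (m' == m)%:R | inr _ => 0 : R end.
    have [||x xv] := @param_valuesP v lk1.
    + by rewrite /= eq_sym (negbTE mi).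
    + by rewrite /= eq_sym (negbTE mj).
    exists x; have -> : lx x = l by apply: funext => a; rewrite /lx xv.
    rewrite (bigD1 m)//= /wx xv /= eqxx mul1r big1 ?addr0 ?oppr_eq0// => m' mm'.
    by rewrite xv /= (negbTE mm') mul0r.
  - move=> p lam lamk lamp.
    have [w [t [wK ->]]] := abnormal_point_decomp lamp (fun w w' => zetaP lam w w' lamk).
    have [x [lxE txE wE] ->] := param_phi lam w t lamk wK; exists x => //.
    rewrite lxE; case: wK => _ /(_ _ (eV1 r)); rewrite wE lie_suml dot_sum; apply: etrans.
    by apply: eq_bigr => m' _; rewrite lieZl dotZ dot_lie_orth_vec.
(* All Pfaffians vanish on normalized values, so [W, W] = 0 by polarization and the equation is t =
   0. *)
exists tx; split; first exact: npolyfun_param_values.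
- pose v (a : param_index) := match a with inl (inl _) => 1 | inl _ => 0 | inr _ => 1 : R end.
  have [x xv] := @param_valuesP v erefl erefl erefl.
  by exists x; rewrite /tx xv oner_eq0.
- move=> p lam lamk lamp.
  have pf0 l r m : l k = 1 -> pfaffian4 (G := G) l i j r m = 0.
    by move=> lk1; apply/eqP/negPn/negP => H; apply: nopf; exists r, m, l.
  have [|w [t [wK ->]]] := @abnormal_point_decomp _ _ G lam p 0 lamp.
    move=> w w' wK w'K; case: (lamk) => lk1 om0.
    have [y [_ _ ->]] := form_kernel_expand om0 wK.
    have [y' [_ _ ->]] := form_kernel_expand om0 w'K.
    rewrite lie_suml; apply: rpred_sum => m _; rewrite lie_sumr; apply: rpred_sum => m' _.
    by rewrite lieZl lieZr (lie_orth_vec_eq0 pf0)// !scaler0 mem0v.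
  have [x [_ txE _] E0] := param_phi lam w 0 lamk wK.
  by exists x; rewrite // -E0 scale0r scaler0.
Qed.

End Chart.

(** * Covering by finitely many charts *)

Lemma small_codim_abnormal_points (R : realType) (N : nat) (G : carnot2 R N) :
  (N <= 7)%N -> small_codim 3 [set p | exists lam, abnormal_point G lam p].
Proof.
move=> N7.
pose S (t : 'I_(\dim (V2 G)) * 'I_(\dim (V1 G)) * 'I_(\dim (V1 G))) :=
  [set p | exists2 lam, chart_forms t.1.1 t.1.2 t.2 lam & abnormal_point G lam p].
apply: (@small_codimS _ _ _ _ [set p | exists t, S t p]).
  move=> p [lam lamp]; have [k lk] := abnormal_point_index lamp.
  pose lam' := (dot lam ((vbasis (V2 G))`_k))^-1 *: lam.
  have lamp' : abnormal_point G lam' p by apply: abnormal_pointZ; rewrite ?invr_eq0.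
  have lk' : dot lam' ((vbasis (V2 G))`_k) = 1 by rewrite dotZl mulVf.
  have [|i [j om0]] := @skew_form_index _ _ _ lam' k; first by rewrite lk' oner_eq0.
  by exists (k, i, j), lam'.
(* The skew form vanishes on the diagonal, so charts with i = j are empty. *)
apply: small_codim_big => -[[k i] j]; have [ij|ij] := eqVneq i j; last exact: small_codim_chart.
apply: (@small_codimS _ _ _ _ [set p | exists t : void, False]).
  by move=> p [lam [_ /=]]; rewrite ij skew_formxx eqxx.
by apply: small_codim_big => -[].
Qed.

(** The point is the image of {x 0 = 0} in R^1 under a constant map. This handles the default value
    of [End]. *)
Lemma small_codim_set1 (R : realType) (N : nat) (p : 'rV[R]_N) :
  (3 <= N)%N -> small_codim 3 [set p].
Proof.
move=> N3.
have [F FE] := @npolyfun_var R 1 0 isT.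
apply: (small_codimS (T := [set p | x in [set x | npeval x F = 0]])).
  by move=> _ ->; exists (fun=> 0) => //=; rewrite -FE.
apply: (@small_codim_param _ _ 1) => [//||c]; last by have := npolyfun_const 1 (p 0 c).
apply/eqP => F0; have := FE (fun=> 1); rewrite F0 /npeval rmorph0 => /eqP.
by rewrite oner_eq0.
Qed.

(** If dim V1 <= 1, all brackets of V1 vanish and V2 = 0. *)
Lemma carnot2_dim_ge3 (R : realType) (N : nat) (G : carnot2 R N) : (3 <= N)%N.
Proof.
have s0 : (0 < \dim (V2 G))%N by rewrite lt0n dimv_eq0; apply/eqP; exact: V2_neq0.
suff n2 : (2 <= \dim (V1 G))%N by have := dim_layers G; lia.
rewrite ltnNge; apply/negP => n1; apply: (@V2_neq0 _ _ G).
apply/eqP; rewrite -subv0 V2_def; apply/span_subvP => x /allpairsP[[u v] /= [uV vV ->]].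
have V1line w : w \in vbasis (V1 G) -> w = (vbasis (V1 G))`_0.
  move=> wV; have {wV} : w \in tval (vbasis (V1 G)) by [].
  have := size_tuple (vbasis (V1 G)).
  move: (tval (vbasis (V1 G))) => [|a [|b l]] //= sz; first by rewrite inE => /eqP.
  by move: n1; rewrite -sz.
by rewrite (V1line u uV) (V1line v vV) liexx mem0v.
Qed.

(** * Absolutely continuous functions with zero derivative *)

Section AbsolutelyContinuous.
Variable R : realType.
Local Notation mu := (@lebesgue_measure R).

Definition abs_continuous (f : R -> R) : Prop :=
  forall e : R, 0 < e -> exists2 d : R, 0 < d &
    forall (n : nat) (a b : 'I_n -> R),
      (forall i, [/\ 0 <= a i, a i <= b i & b i <= 1]) ->
      trivIset setT (fun i => `]a i, b i[%classic) ->
      \sum_i (b i - a i) < d ->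
      \sum_i `|f (b i) - f (a i)| < e.

Lemma is_derive_dist_le (f : R -> R) (x df e : R) :
    is_derive x 1 f df -> 0 < e ->
  exists2 d, 0 < d & forall y, `|y - x| < d -> `|f y - f x - df * (y - x)| <= e * `|y - x|.
Proof.
move=> [dfx <-] e0.
have /cvgrPdist_le /(_ e e0) [d /= d0 dP] := dfx.
exists d => // y yx; have [->|yneqx] := eqVneq y x.
  by rewrite !subrr mulr0 subr0 normr0 mulr0.
have yx0 : y - x != 0 by rewrite subr_eq0.
have := dP (y - x); rewrite /ball /= sub0r normrN => /(_ yx yx0).
rewrite {1}/GRing.scale /= scaler1 subrK => /(ler_wpM2r (normr_ge0 (y - x))).
rewrite -normrM mulrBl mulrAC mulVf// mul1r distrC; exact: le_trans.
Qed.

Lemma negligible_open_cover (A : set R) (e : R) : mu.-negligible A -> 0 < e ->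
  exists O : set R, [/\ open O, A `<=` O & (mu O < e%:E)%E].
Proof.
move=> [B [mB B0 AB]] e0.
have [|O [oO BO Oe]] := @lebesgue_regularity_outer R B e mB _ e0.
  by rewrite [ltLHS]B0 ltry.
exists O; split=> //; first exact: subset_trans BO.
apply: le_lt_trans Oe; rewrite -{1}(setDUK BO).
apply: le_trans (measureU2 _ _ _) _ => //.
  by apply: measurableD => //; exact: open_measurable.
by rewrite [X in (X + _)%E]B0 add0e.
Qed.

Lemma sum_itv_length_le (O : set R) (n : nat) (a b : 'I_n -> R) :
    open O -> (forall i, a i <= b i) -> (forall i, `]a i, b i[%classic `<=` O) ->
    trivIset setT (fun i => `]a i, b i[%classic) ->
  ((\sum_i (b i - a i))%:E <= mu O)%E.
Proof.
move=> oO ab abO tI.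
have -> : ((\sum_i (b i - a i))%:E = \sum_i mu `]a i, b i[%classic)%E.
  rewrite -sumEFin; apply: eq_bigr => i _; rewrite lebesgue_measure_itv /= lte_fin.
  by have := ab i; rewrite le_eqVlt => /orP[/eqP->|->]; rewrite ?ltxx ?subrr.
have mU : measurable (\big[setU/set0]_(i < n) `]a i, b i[%classic).
  by apply: bigsetU_measurable => i _; exact: measurable_itv.
rewrite -measure_semi_additive_ord//.
apply: le_measure; rewrite ?inE//; first exact: open_measurable.
apply: (big_ind (fun X => X `<=` O)) => [x []|X Y XO YO x [/XO|/YO]|i _]//.
Qed.


(* Creeping along [0, t]: outside an open set O of small measure that contains
   the exceptional points the increments of f are at most e times the length,
   and the intervals spent in O contribute at most e by absolute continuity. *)
Lemma abs_continuous_derive0 (f : R -> R) : abs_continuous f ->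
    {ae mu, forall t : R, t \in `[0, 1] -> is_derive t 1 f 0} ->
  forall t : R, t \in `[0, 1] -> f t = f 0.
Proof.
move=> acf aef t /[!in_itv]/= /andP[t0 t1].
suff H (e : R) : 0 < e -> `|f t - f 0| <= e * 2.
  apply/eqP; rewrite -subr_eq0 -normr_le0; apply/ler_addgt0Pr => e e0.
  by rewrite add0r; have := H (e / 2); rewrite divfK//; apply; rewrite divr_gt0.
move=> e0; have [d d0 acd] := acf e e0.
have [ O [oO badO Od]] := negligible_open_cover aef d0.
(* [l] lists, from right to left, the intervals spent in O up to s; the rest of the increment is at
   most e * s. *)
pose ok s (l : seq (R * R)) := [/\ forall p, p \in l ->
    [/\ 0 <= p.1, p.1 <= p.2, p.2 <= s & `]p.1, p.2[%classic `<=` O],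
    pairwise (fun p q => q.2 <= p.1) l &
    `|f s - f 0| <= e * s + \sum_(p <- l) `|f p.2 - f p.1| ].
pose Q (s : R) := [/\ 0 <= s, s <= t & exists l, ok s l].
have Q0 : Q 0.
  split=> //; exists [::]; split=> //.
  by rewrite big_nil subrr normr0 mulr0 addr0.
have step (s s' : R) : Q s -> s <= s' -> s' <= t ->
    `|f s' - f s| <= e * (s' - s) \/ `]s, s'[%classic `<=` O -> Q s'.
  move=> [s0 st [l [lin lpair lf]]] ss' s't.
  have tri : `|f s' - f 0| <= `|f s' - f s| + `|f s - f 0| by exact: ler_distD.
  split=> //; first exact: le_trans ss'.
  case: H => H; [exists l|exists ((s, s') :: l)].
    split=> // [p /lin[p0 p1 p2 pO]|]; first by split=> //; exact: le_trans ss'.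
    by apply: le_trans tri _; nra.
  split=> [p| |].
  - rewrite inE => /orP[/eqP->//|/lin[p0 p1 p2 pO]]; split=> //.
    exact: le_trans ss'.
  - by rewrite /= lpair andbT; apply/allP => p /lin[].
  - rewrite big_cons; apply: le_trans tri _ => /=.
    have : e * s <= e * s' by rewrite ler_pM2l.
    lra.
suff [_ _ [l [lin lpair lf]]] : Q t.
  apply: le_trans lf _; rewrite mulr2n mulrDr mulr1; apply: lerD.
    by rewrite -[leRHS]mulr1 ler_pM2l.
  pose a (i : 'I_(size l)) := (tnth (in_tuple l) i).1.
  pose b (i : 'I_(size l)) := (tnth (in_tuple l) i).2.
  have inl i : tnth (in_tuple l) i \in l by exact: mem_tnth.
  have tI : trivIset setT (fun i => `]a i, b i[%classic).
    have ba (i j : 'I_(size l)) : (i < j)%N -> b j <= a i.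
      move=> ij; have /(pairwiseP (0, 0)) := lpair; rewrite /a /b !(tnth_nth (0, 0)).
      by apply; rewrite ?inE.
    move=> i j _ _ [x [] /=]; rewrite !in_itv /= => /andP[ax xb] /andP[ax' xb'].
    by case: (ltngtP i j) => [/ba ij|/ba ji|/ord_inj//]; exfalso; lra.
  rewrite big_tnth; apply/ltW/(acd _ a b) => // [i|].
    by have [p0 p1 p2 _] := lin _ (inl i); split=> //; apply: le_trans t1.
  rewrite -lte_fin; apply: le_lt_trans Od; apply: sum_itv_length_le => // i.
    by have [] := lin _ (inl i).
  by have [] := lin _ (inl i).
(* From a reached point near the supremum the creep continues past it, unless t comes first. *)
pose S := [set s | Q s]; pose sg := sup S.
have hS : has_sup S.
  by split; [exists 0|exists t => s []].
have sgt : sg <= t by apply: ge_sup => [|s []//]; exists 0.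
have sg0 : 0 <= sg by apply: ub_le_sup => //; case: hS.
(* Near the supremum either O contains a neighbourhood, or the derivative there is 0 and bounds the
   increments. *)
have [dl dl0 dlP] : exists2 dl, 0 < dl & forall u v, u <= sg -> sg <= v ->
    sg - dl < u -> v < sg + dl -> `|f v - f u| <= e * (v - u) \/ `]u, v[%classic `<=` O.
  have [sgO|sgO] := pselect (O sg).
    have /nbhs_ballP [dl /= dl0 dlO] : nbhs sg O by exact: open_nbhs_nbhs.
    exists dl => // u v us sv du vd; right=> x /=; rewrite in_itv /= => /andP[ux xv].
    by apply: dlO; rewrite /ball /= ltr_norml; apply/andP; split; lra.
  have dsg : is_derive sg 1 f 0.
    apply: contrapT => nd; apply/sgO/badO => /= H; apply/nd/H.
    by rewrite in_itv /= sg0; apply: le_trans t1.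
  have [dl dl0 dlP] := is_derive_dist_le dsg e0.
  exists dl => // u v us sv du vd; left.
  have {}dlP y : `|y - sg| < dl -> `|f y - f sg| <= e * `|y - sg|.
    by move=> /dlP; rewrite mul0r subr0.
  have Hv : `|f v - f sg| <= e * (v - sg).
    have vE : `|v - sg| = v - sg by rewrite ger0_norm ?subr_ge0.
    by rewrite -[in leRHS]vE; apply: dlP; rewrite vE; lra.
  have Hu : `|f u - f sg| <= e * (sg - u).
    have uE : `|u - sg| = sg - u by rewrite distrC ger0_norm ?subr_ge0.
    by rewrite -uE; apply: dlP; rewrite uE; lra.
  have := ler_distD (f sg) (f v) (f u); rewrite [`|f sg - f u|]distrC; nra.
have [s Qs ss] := sup_adherent dl0 hS.
have ssg : s <= sg by apply: ub_le_sup => //; case: hS.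
pose s' := Num.min (sg + dl / 2) t.
have sgs' : sg <= s' by rewrite /s' le_min sgt andbT lerDl divr_ge0// ltW.
have Qs' : Q s'.
  apply: (step s) => //; first exact: le_trans sgs'.
    by rewrite /s' ge_min lexx orbT.
  apply: dlP => //; apply: (@le_lt_trans _ _ (sg + dl / 2)); last lra.
  by rewrite /s' ge_min lexx.
have : s' <= sg by apply: ub_le_sup => //; case: hS.
rewrite /s'; move: Qs'; rewrite /s'; case: (leP (sg + dl / 2) t) => [_ _|//].
by rewrite gerDl leNgt divr_gt0.
Qed.

End AbsolutelyContinuous.

(** * Operations on absolutely continuous functions; primitives *)

Section AbsolutelyContinuousOperations.
Variable R : realType.
Local Notation mu := (@lebesgue_measure R).

(** The comparison criterion to which sums, products and Lipschitz functions reduce. *)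
Lemma abs_continuous_le (F f h : R -> R) (A : R) : 0 < A ->
    abs_continuous f -> abs_continuous h ->
    (forall a b, 0 <= a -> a <= b -> b <= 1 ->
       `|F b - F a| <= A * (`|f b - f a| + `|h b - h a|)) ->
  abs_continuous F.
Proof.
move=> A0 acf ach FA e e0; have e2 : 0 < e / A / 2 by rewrite !divr_gt0.
have [d1 d10 d1P] := acf _ e2; have [d2 d20 d2P] := ach _ e2.
exists (Num.min d1 d2); first by rewrite lt_min d10.
move=> n a b ab tI; rewrite lt_min => /andP[sd1 sd2].
apply: (@le_lt_trans _ _ (A * (\sum_i `|f (b i) - f (a i)| + \sum_i `|h (b i) - h (a i)|))).
  by rewrite -big_split mulr_sumr; apply: ler_sum => i _; have [? ? ?] := ab i; exact: FA.
rewrite mulrC -ltr_pdivlMr// (splitr (e / A)).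
exact: ltrD (d1P n a b ab tI sd1) (d2P n a b ab tI sd2).
Qed.

Lemma abs_continuous_id : abs_continuous (@id R).
Proof.
move=> e e0; exists e => // n a b ab _; apply: le_lt_trans; apply: ler_sum => i _.
by have [_ abi _] := ab i; rewrite ger0_norm// subr_ge0.
Qed.

Lemma lipschitz_abs_continuous (F : R -> R) (A : R) :
    (forall a b, 0 <= a -> a <= b -> b <= 1 -> `|F b - F a| <= A * (b - a)) ->
  abs_continuous F.
Proof.
move=> FA; apply: (@abs_continuous_le F id id (`|A| + 1)) => [|||a b a0 ab b1].
- by rewrite ltr_wpDl.
- exact: abs_continuous_id.
- exact: abs_continuous_id.
apply: le_trans (FA _ _ a0 ab b1) _; have ba : 0 <= b - a by rewrite subr_ge0.
rewrite (ger0_norm ba); have := ler_norm A; have := normr_ge0 A.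
move: `|A| => A'; nra.
Qed.

Lemma abs_continuousD (f h : R -> R) : abs_continuous f -> abs_continuous h ->
  abs_continuous (fun s => f s + h s).
Proof.
move=> acf ach; apply: (abs_continuous_le ltr01 acf ach) => a b _ _ _.
by rewrite mul1r opprD addrACA; exact: ler_normD.
Qed.

Lemma abs_continuousB (f h : R -> R) : abs_continuous f -> abs_continuous h ->
  abs_continuous (fun s => f s - h s).
Proof.
move=> acf ach; apply: (abs_continuous_le ltr01 acf ach) => a b _ _ _.
by rewrite mul1r opprD addrACA -opprD; exact: ler_normB.
Qed.

(** This retraction onto [0, 1] turns functions controlled on the interval only into functions
    continuous on the line. *)
Definition clamp01 (s : R) : R := Num.max 0 (Num.min s 1).

Lemma clamp01_itv s : clamp01 s \in `[0, 1].
Proof. by rewrite in_itv /= /clamp01 le_max lexx ge_max ler01 ge_min lexx orbT. Qed.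

Lemma clamp01_id (s : R) : s \in `[0, 1] -> clamp01 s = s.
Proof. by rewrite in_itv /= => /andP[s0 s1]; rewrite /clamp01 (min_l s1) (max_r s0). Qed.

Lemma clamp01_lip x y : x <= y -> 0 <= clamp01 y - clamp01 x <= y - x.
Proof.
rewrite /clamp01 !maxEle !minEle => xy.
case: (lerP x 1) => x1; case: (lerP y 1) => y1 /=; rewrite ?ler01;
  try case: (lerP 0 x) => x0; try case: (lerP 0 y) => y0 /=;
  apply/andP; split; lra.
Qed.

Lemma abs_continuous_clamp (f : R -> R) : abs_continuous f ->
  continuous (fun s => f (clamp01 s)).
Proof.
move=> acf x; apply/cvgrPdist_lt => /= e e0; have [d d0 dP] := acf e e0.
have close a b : a <= b -> b - a < d -> `|f (clamp01 b) - f (clamp01 a)| < e.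
  move=> ab bad; have /andP[c0 cba] := clamp01_lip ab.
  have := clamp01_itv a; have := clamp01_itv b; rewrite !in_itv /=.
  move=> /andP[_ b1] /andP[a0 _].
  have := @dP 1 (fun=> clamp01 a) (fun=> clamp01 b); rewrite !big_ord1; apply.
  - by move=> _; split=> //; rewrite -subr_ge0.
  - by move=> i j _ _ _; rewrite (ord1 i) (ord1 j).
  - exact: le_lt_trans bad.
near=> y; have xy : `|x - y| < d by near: y; exact: (cvgr_dist_lt id).
move: xy; rewrite ltr_norml => /andP[xy yx].
by have [?|?] := leP x y; [rewrite distrC|]; apply: close; lra.
Unshelve. all: by end_near. Qed.

Lemma abs_continuous_bounded (f : R -> R) : abs_continuous f ->
  exists2 B, 0 < B & forall t : R, t \in `[0, 1] -> `|f t| <= B.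
Proof.
move=> /abs_continuous_clamp cf.
have [|c _ cP] := @EVT_max R (fun s => `|f (clamp01 s)|) 0 1 ler01.
  apply: continuous_subspaceT => x.
  by apply: (@continuous_comp _ _ _ (fun s => f (clamp01 s)) Num.norm); [exact: cf|exact: norm_continuous].
exists (`|f (clamp01 c)| + 1); first by rewrite ltr_wpDl.
by move=> t t01; have := cP t t01; rewrite clamp01_id// => /le_trans; apply; rewrite lerDl.
Qed.

Lemma abs_continuousM (f h : R -> R) : abs_continuous f -> abs_continuous h ->
  abs_continuous (fun s => f s * h s).
Proof.
move=> acf ach; have [B B0 fB] := abs_continuous_bounded acf.
have [C C0 hC] := abs_continuous_bounded ach.
apply: (abs_continuous_le (addr_gt0 B0 C0) acf ach) => a b a0 ab b1.
have -> : f b * h b - f a * h a = f b * (h b - h a) + h a * (f b - f a) by ring.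
have b01 : b \in `[0, 1] by rewrite in_itv /= b1 (le_trans a0).
have a01 : a \in `[0, 1] by rewrite in_itv /= a0 (le_trans ab).
apply: le_trans (ler_normD _ _) _; rewrite !normrM.
have := fB b b01; have := hC a a01.
have := normr_ge0 (f b - f a); have := normr_ge0 (h b - h a).
move: `|_| => p; move: `|_| => q; nra.
Qed.

Lemma primitive_itv01 (h : R -> R) : continuous h ->
  exists2 F : R -> R, F 0 = 0 & forall t : R, t \in `[0, 1] -> is_derive t 1 F (h t).
Proof.
move=> ch.
(* Integrating over [-1, 2] makes 0 and 1 interior, so the derivative there is two-sided. *)
have int2 : mu.-integrable `[-1, 2] (EFin \o h).
  apply: continuous_compact_integrable; first exact: segment_compact.
  exact: continuous_subspaceT.
have [P PP] : exists P : R -> R, forall t : R, t \in `[0, 1] ->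
    derivable P t 1 /\ derive1 P t = h t.
  eexists => t /[!in_itv] /= /andP[t0 t1].
  apply: (continuous_FTC1_closed _ int2); [lra|lra|exact: ch].
exists (fun x => P x - P 0); first by rewrite subrr.
move=> t t01; have [dP Pt] := PP t t01.
have dP' : is_derive t 1 P (h t) by apply: DeriveDef; [exact: dP|rewrite -derive1E].
by have := is_deriveB dP' (is_derive_cst (P 0) t 1); rewrite subr0.
Qed.

Lemma is_derive_lipschitz (F h : R -> R) (B : R) :
    (forall t : R, t \in `[0, 1] -> is_derive t 1 F (h t)) ->
    (forall t : R, t \in `[0, 1] -> `|h t| <= B) ->
  forall a b, 0 <= a -> a <= b -> b <= 1 -> `|F b - F a| <= B * (b - a).
Proof.
move=> dF hB a b a0; rewrite le_eqVlt => /orP[/eqP-> _|ab b1].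
  by rewrite !subrr normr0 mulr0.
have sub (c : R) : a <= c <= b -> c \in `[0, 1].
  by move=> /andP[ac cb]; rewrite in_itv /= (le_trans a0 ac) (le_trans cb b1).
have dFab (x : R) : x \in `]a, b[ -> is_derive x 1 F (h x).
  by rewrite in_itv /= => /andP[ax xb]; apply: dF; apply: sub; rewrite (ltW ax) (ltW xb).
have cF : {within `[a, b], continuous F}.
  apply: derivable_within_continuous => x; rewrite in_itv /= => xab.
  by have [] := dF x (sub x xab).
have [c + ->] := MVT ab dFab cF.
rewrite in_itv /= => /andP[ac cb].
have ba : 0 <= b - a by rewrite subr_ge0 ltW.
rewrite normrM (ger0_norm ba); apply: ler_wpM2r => //.
by apply: hB; apply: sub; rewrite (ltW ac) (ltW cb).
Qed.

End AbsolutelyContinuousOperations.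

(** * Calculus in coordinates for vector-valued curves *)

Section VectorCalculus.
Variables (R : realType) (N : nat).
Local Notation g := 'rV[R]_N.
Local Notation mu := (@lebesgue_measure R).

Lemma linear_rV_continuous (f : {linear g -> g}) : continuous f.
Proof.
move=> x.
have -> : (f : g -> g) = fun y => \sum_j (y 0 j *: f (delta_mx 0 j)).
  by apply: funext => y; rewrite [in LHS](row_sum_delta y) linear_sum; apply: eq_bigr => j _; rewrite linearZ.
apply: cvg_big; [exact: add_continuous|exact: nbhs_filter|move=> j _].
apply: cvgZr_tmp; [exact: nbhs_filter|exact: (@coord_continuous R 1 N 0 j x)].
Qed.

Lemma is_derive_rowP (h : R -> g) (t : R) (v : g) :
  is_derive t 1 h v <-> forall i, is_derive t 1 (fun s => h s 0 i) (v 0 i).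
Proof.
split=> [[dh <-] i|H].
  apply: DeriveDef; first exact: (derivable_mxP h t 1).1.
  by rewrite derive_mx// mxE.
have dh : derivable h t 1.
  by apply/derivable_mxP => i j; rewrite (ord1 i); have [] := H j.
apply: DeriveDef => //; rewrite derive_mx//; apply/rowP => j; rewrite mxE.
by have [_ ->] := H j.
Qed.

Lemma is_derive_dot (h : R -> g) (t : R) (v lam : g) :
  is_derive t 1 h v -> is_derive t 1 (fun s => dot lam (h s)) (dot lam v).
Proof.
move=> /is_derive_rowP dh.
have := is_derive_sum (fun i => is_deriveZ (lam 0 i) (dh i)).
rewrite (_ : \sum_(i < N) _ = fun s => dot lam (h s))//.
by apply: funext => s; rewrite fct_sumE.
Qed.

Lemma dot_norm_le (lam : g) : exists2 K, 0 < K & forall x, `|dot lam x| <= K * `|x|.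
Proof.
exists (1 + \sum_i `|lam 0 i|); first by rewrite ltr_pwDl// sumr_ge0.
move=> x; rewrite mulrDl mul1r; apply: le_trans (_ : _ <= (\sum_i `|lam 0 i|) * `|x|) _; last first.
  by rewrite lerDr.
rewrite mulr_suml; apply: le_trans (ler_norm_sum _ _ _) _; apply: ler_sum => i _.
rewrite normrM ler_wpM2l// [leRHS]/Num.Def.normr/= mx_normrE.
exact: (le_bigmax _ _ (0, i)).
Qed.

Lemma abs_continuous01_dot (h : R -> g) lam :
  abs_continuous01 h -> abs_continuous (fun s => dot lam (h s)).
Proof.
move=> ach e e0; have [K K0 dotK] := dot_norm_le lam.
have [d d0 dP] := ach (e / K) (divr_gt0 e0 K0); exists d => // n a b ab tI sd.
apply: le_lt_trans (_ : K * \sum_i `|h (b i) - h (a i)| < e); last first.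
  by rewrite mulrC -ltr_pdivlMr//; exact: dP.
by rewrite mulr_sumr; apply: ler_sum => i _; rewrite -dotB.
Qed.

Lemma norm_rV_le_sum (x : g) : `|x| <= \sum_i `|x 0 i|.
Proof.
rewrite [leLHS]/Num.Def.normr/= mx_normrE; apply: bigmax_le => [|[i j] _ /=].
  exact: sumr_ge0.
by rewrite (ord1 i) (bigD1 j)//= lerDl sumr_ge0.
Qed.

Lemma abs_continuous01_coord (h : R -> g) :
  (forall i, abs_continuous (fun s => h s 0 i)) -> abs_continuous01 h.
Proof.
move=> ach e e0.
(* N + 1 avoids a division by zero and makes the final inequality strict. *)
have eN : 0 < e / N.+1%:R by rewrite divr_gt0.
have [d d0 dP] : exists2 d, 0 < d & forall i (n : nat) (a b : 'I_n -> R),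
      (forall i, [/\ 0 <= a i, a i <= b i & b i <= 1]) ->
      trivIset setT (fun i => `]a i, b i[%classic) ->
      \sum_i (b i - a i) < d ->
      \sum_j `|h (b j) 0 i - h (a j) 0 i| < e / N.+1%:R.
  have /choice [d dP] i : exists d, 0 < d /\ forall (n : nat) (a b : 'I_n -> R),
      (forall i, [/\ 0 <= a i, a i <= b i & b i <= 1]) ->
      trivIset setT (fun i => `]a i, b i[%classic) ->
      \sum_i (b i - a i) < d ->
      \sum_j `|h (b j) 0 i - h (a j) 0 i| < e / N.+1%:R.
    by have [d d0 dP] := ach i _ eN; exists d.
  exists (\big[Num.min/1]_i d i).
    by apply: lt_bigmin => // i _; exact: (dP i).1.
  move=> i n a b ab tI sd; apply: (dP i).2 => //; apply: lt_le_trans sd _.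
  exact: bigmin_le.
exists d => // n a b ab tI sd.
apply: (@le_lt_trans _ _ (\sum_(i < N) \sum_j `|h (b j) 0 i - h (a j) 0 i|)).
  rewrite exchange_big /=; apply: ler_sum => j _.
  by apply: le_trans (norm_rV_le_sum _) _; apply: ler_sum => i _; rewrite !mxE.
apply: (@le_lt_trans _ _ (\sum_(i < N) e / N.+1%:R)).
  by apply: ler_sum => i _; exact/ltW/dP.
rewrite sumr_const card_ord -[ltLHS]mulr_natr mulrAC ltr_pdivrMr// ltr_pM2l//.
by rewrite ltr_nat.
Qed.

End VectorCalculus.

(** * Lifts: uniqueness and confinement to W + [W, W] *)

Section Lifts.
Variables (R : realType) (N : nat) (G : carnot2 R N).
Local Notation g := 'rV[R]_N.
Local Notation mu := (@lebesgue_measure R).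

(** Left translation is affine in these coordinates, so its differential is its linear part. *)
Lemma diff_mulG (x v : g) : 'd (mulG G x) (0 : g) v = v + 2^-1 *: lie G x v.
Proof.
pose L (y : g) : g := y + 2^-1 *: lie G x y.
have linL : linear L.
  move=> a y z; rewrite /L lieDr lieZr; apply/rowP => i; rewrite !mxE; ring.
pose L' : {linear g -> g} := HB.pack L (GRing.isLinear.Build _ _ _ _ L linL).
have cL : continuous L' by exact: linear_rV_continuous.
have dL : differentiable L' (0 : g) by exact: linear_differentiable.
have -> : mulG G x = cst x + L'.
  by apply: funext => y; rewrite /mulG /= -addrA.
have isL : is_diff (0 : g) L' L' by apply: DiffDef => //; exact: diff_lin.
have isx : is_diff (0 : g) (cst x : g -> g) 0 by exact: is_diff_cst.
by have [_ ->] := is_diffD isx isL; rewrite add0r.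
Qed.

Lemma lift_dot u gamma lam : lift_of G u gamma ->
  abs_continuous (fun t => dot lam (gamma t)) /\
  {ae mu, forall t : R, t \in `[0, 1] ->
    is_derive t 1 (fun t => dot lam (gamma t)) (dot lam (u t + 2^-1 *: lie G (gamma t) (u t)))}.
Proof.
move=> [_ acg dg]; split; first exact: abs_continuous01_dot.
move: dg; apply: filterS; first exact: (ae_filter_ringOfSetsType mu).
move=> t dgt /dgt dgt'.
by rewrite -diff_mulG; exact: is_derive_dot.
Qed.

(** The difference of two lifts has derivative 1/2 [gamma1 - gamma2, u]. Forms that kill V2 are
    constant on it, so it stays in V2; then the bracket vanishes and every coordinate is
    constant. *)
Lemma lift_unique u gamma1 gamma2 :
    (forall t : R, t \in `[0, 1] -> u t \in V1 G) ->
    lift_of G u gamma1 -> lift_of G u gamma2 ->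
  forall t : R, t \in `[0, 1] -> gamma1 t = gamma2 t.
Proof.
move=> uV1 l1 l2.
have g10 : gamma1 0 = 0 by case: l1.
have g20 : gamma2 0 = 0 by case: l2.
have cst lam : (forall t : R, t \in `[0, 1] ->
     dot lam (lie G (gamma1 t - gamma2 t) (u t)) = 0) ->
    forall t : R, t \in `[0, 1] -> dot lam (gamma1 t - gamma2 t) = 0.
  move=> lam0 t t01.
  have -> : 0 = dot lam (gamma1 0 - gamma2 0) by rewrite g10 g20 subrr dot0.
  pose h s := dot lam (gamma1 s - gamma2 s); rewrite -/(h t) -/(h 0).
  have hE : h = (fun s => dot lam (gamma1 s)) - (fun s => dot lam (gamma2 s)).
    by apply: funext => s; rewrite /h dotB.
  apply: abs_continuous_derive0 => //.
    move=> e e0; have [_ ac1 _] := l1; have [_ ac2 _] := l2.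
    have ac : abs_continuous01 (fun s => gamma1 s - gamma2 s).
      apply: abs_continuous01_coord => i e' e'0.
      have := abs_continuousB (abs_continuous01_dot (delta_mx 0 i) ac1)
        (abs_continuous01_dot (delta_mx 0 i) ac2).
      move=> /(_ e' e'0)[d d0 dP]; exists d => // n a b ab tI /(dP n a b ab tI).
      by under eq_bigr do rewrite !dot_delta; under [in X in _ -> X]eq_bigr do rewrite !mxE.
    exact: abs_continuous01_dot ac e e0.
  have [_ d1] := lift_dot lam l1; have [_ d2] := lift_dot lam l2.
  move: d1 d2; apply: filterS2; first exact: (ae_filter_ringOfSetsType mu).
  move=> s d1 d2 s01.
  have := is_deriveB (d1 s01) (d2 s01); rewrite -hE -dotB.
  rewrite opprD addrACA subrr add0r -scalerBr dotZ.
  have -> : lie G (gamma1 s) (u s) - lie G (gamma2 s) (u s) = lie G (gamma1 s - gamma2 s) (u s).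
    by rewrite lieDl -(scaleN1r (gamma2 s)) lieZl scaleN1r.
  by rewrite lam0// mulr0.
have V2sub t : t \in `[0, 1] -> gamma1 t - gamma2 t \in V2 G.
  move=> t01; apply: contrapT => /negP /separating_form [lam [lamV2 /eqP]]; apply.
  apply: cst t01 => s s01; apply: lamV2.
  rewrite V2_def; have : gamma1 s - gamma2 s \in (V1 G + V2 G)%VS by rewrite V12_full memvf.
  case/memv_addP => v vV1 [w wV2 ->]; rewrite lieDl.
  have -> : lie G w (u s) = 0.
    apply/eqP; rewrite -memv0 -(V21_eq0 G); apply: mem_bracket_space => //; exact: uV1.
  by rewrite addr0; apply: mem_bracket_space => //; exact: uV1.
move=> t t01; apply/eqP; rewrite -subr_eq0; apply/eqP/rowP => i; rewrite [RHS]mxE -dot_delta.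
apply: cst t01 => s s01.
have -> : lie G (gamma1 s - gamma2 s) (u s) = 0.
  by apply/eqP; rewrite -memv0 -(V21_eq0 G); apply: mem_bracket_space; [exact: V2sub|exact: uV1].
exact: dot0.
Qed.

Lemma End_lift u gamma : (forall t : R, t \in `[0, 1] -> u t \in V1 G) ->
  lift_of G u gamma -> End G u = gamma 1.
Proof.
move=> uV1 lg.
have lc : lift_of G u (curve G u) by apply: getPex; exists gamma.
by apply: (lift_unique uV1 lc lg); rewrite in_itv /= ler01 lexx.
Qed.

(** The difference quotient is tested inside [0, 1], to the right of t when t <= 1/2 and to the left
    otherwise, which covers the end points. *)
Lemma is_derive_eq0_itv (h : R -> R) (t d : R) : t \in `[0, 1] ->
  (forall s : R, s \in `[0, 1] -> h s = 0) -> is_derive t 1 h d -> d = 0.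
Proof.
move=> t01 h0 dh; apply/eqP; rewrite -normr_le0; apply/ler_addgt0Pr => e e0; rewrite add0r.
have [r r0 rP] := is_derive_dist_le dh e0.
suff [s [s01 st sr]] : exists s, [/\ s \in `[0, 1], s != t & `|s - t| < r].
  have := rP s sr; rewrite !h0// subrr sub0r normrN normrM ler_pM2r//.
  by rewrite normr_gt0 subr_eq0.
move: t01; rewrite in_itv /= => /andP[t0 t1].
pose k := Num.min (r / 2) (1 / 2).
have k0 : 0 < k by rewrite lt_min !divr_gt0.
have kr : k < r by rewrite gt_min ltr_pdivrMr// ltr_pMr// ltr1n.
have k12 : k <= 1 / 2 by rewrite ge_min lexx orbT.
have [t12|t12] := leP t (1 / 2).
  have tk : t + k - t = k by ring.
  exists (t + k); rewrite in_itv /= tk gtr0_norm// -subr_eq0 tk gt_eqF//; split=> //.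
  by apply/andP; split; lra.
have tk : t - k - t = - k by ring.
exists (t - k); rewrite in_itv /= tk normrN gtr0_norm// -subr_eq0 tk oppr_eq0 gt_eqF//.
by split=> //; apply/andP; split; lra.
Qed.

(** Differentiating lam [gamma, y] = 0 puts u in W almost everywhere. The V1 component of gamma is
    in W too, so the derivative nu (u) + 1/2 nu [gamma, u] of nu (gamma) vanishes. *)
Lemma lift_confined u gamma lam :
    (forall t : R, t \in `[0, 1] -> u t \in V1 G) -> lift_of G u gamma ->
    (forall (t : R) y, t \in `[0, 1] -> y \in V1 G -> dot lam (lie G (gamma t) y) = 0) ->
  forall nu, (forall w, form_kernel G lam w -> dot nu w = 0) ->
    (forall w w', form_kernel G lam w -> form_kernel G lam w' -> dot nu (lie G w w') = 0) ->
  dot nu (gamma 1) = 0.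
Proof.
move=> uV1 lg lam0 nu nuW nuWW.
have g0 : gamma 0 = 0 by case: lg.
rewrite -(dot0 nu) -g0; have [ac dnu] := lift_dot nu lg.
apply: (abs_continuous_derive0 ac); last by rewrite in_itv /= ler01 lexx.
case: lg => _ _; move: dnu; apply: filterS2; first exact: (ae_filter_ringOfSetsType mu).
move=> t dnu dg t01.
have uW : form_kernel G lam (u t).
  split=> [|y yV1]; first exact: uV1.
  pose nu' : g := \row_i dot lam (lie G (delta_mx 0 i) y).
  have nu'E x : dot nu' x = dot lam (lie G x y).
    rewrite [in RHS](row_sum_delta x) lie_suml dot_sum; apply: eq_bigr => i _.
    by rewrite mxE lieZl dotZ mulrC.
  have := is_derive_dot nu' (dg t01); rewrite diff_mulG.
  move=> /(is_derive_eq0_itv t01); rewrite !nu'E lieDl lieZl lie_step2l scaler0 addr0.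
  by apply=> s s01; rewrite nu'E lam0.
have : gamma t \in (V1 G + V2 G)%VS by rewrite V12_full memvf.
case/memv_addP => v vV1 [w wV2 gE].
have wu x : x \in V1 G -> lie G w x = 0.
  by move=> xV1; apply/eqP; rewrite -memv0 -(V21_eq0 G); exact: mem_bracket_space.
have vW : form_kernel G lam v.
  by split=> // y yV1; rewrite -(lam0 t y t01 yV1) gE lieDl wu// addr0.
have := dnu t01; rewrite dotD dotZ gE lieDl wu ?uV1// addr0.
by rewrite nuW// nuWW// mulr0 addr0.
Qed.

End Lifts.

(** * Explicit variation of a lift *)

Section Variation.
Variables (R : realType) (N : nat) (G : carnot2 R N).
Local Notation g := 'rV[R]_N.
Local Notation mu := (@lebesgue_measure R).

Lemma linear_dot (L : g -> g) (i : 'I_N) : linear L ->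
  exists nu, forall x, L x 0 i = dot nu x.
Proof.
move=> linL; pose L' : {linear g -> g} := HB.pack L (GRing.isLinear.Build _ _ _ _ L linL).
exists (\row_j L (delta_mx 0 j) 0 i) => x.
rewrite -[L]/(L' : g -> g) [in LHS](row_sum_delta x) linear_sum summxE.
by apply: eq_bigr => j _; rewrite linearZ !mxE mulrC.
Qed.

Lemma lift_primitive u gamma : lift_of G u gamma ->
  exists2 Gam : R -> g, Gam 0 = 0 &
    forall t : R, t \in `[0, 1] -> is_derive t 1 Gam (gamma t).
Proof.
move=> [_ acg _].
have cg i : continuous (fun s => dot (delta_mx 0 i) (gamma (clamp01 s))).
  by apply: (abs_continuous_clamp (f := fun s => dot (delta_mx 0 i) (gamma s))); exact: abs_continuous01_dot.
have /choice [F FP] i : exists F : R -> R, F 0 = 0 /\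
    forall t : R, t \in `[0, 1] -> is_derive t 1 F (gamma t 0 i).
  have [F F0 dF] := primitive_itv01 (cg i); exists F; split=> // t t01.
  by have := dF t t01; rewrite dot_delta clamp01_id.
exists (fun t => \row_i F i t); first by apply/rowP => i; rewrite !mxE (FP i).1.
move=> t t01; apply/is_derive_rowP => i.
rewrite (_ : (fun s => _) = F i); first exact: (FP i).2.
by apply: funext => s; rewrite mxE.
Qed.

Definition step_control (tau : R) (y : g) (t : R) : g := (t < tau)%R%:R *: y.

(* With Gam a primitive of gamma, this is the lift of u + step_control tau y:
   the terms of second order in y cancel because [y, y] = 0, and the first-order
   term [phi y, u] is integrated by parts against gamma. *)
Definition varied_curve (gamma Gam : R -> g) (tau : R) (y : g) (t : R) : g :=
  let phi := Num.min t tau in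
  gamma t + phi *: y + (phi / 2) *: lie G y (gamma t) + lie G (Gam phi) y.

Lemma is_derive_min (t tau : R) : t != tau ->
  is_derive t 1 (fun s => Num.min s tau) (t < tau)%R%:R.
Proof.
move=> tn; have [ttau|taut] := ltP t tau; rewrite ?mulr1n ?mulr0n.
  apply: (@near_eq_is_derive _ _ _ id).
  near=> s; apply/esym/min_l/ltW; near: s; exact: lt_nbhsl.
have {}taut : tau < t by rewrite lt_neqAle eq_sym tn.
apply: (@near_eq_is_derive _ _ _ (cst tau)).
by near=> s; apply/esym/min_r/ltW; near: s; exact: lt_nbhsr.
Unshelve. all: by end_near. Qed.

Lemma min_itv01 (t tau : R) : t \in `[0, 1] -> tau \in `[0, 1] -> Num.min t tau \in `[0, 1].
Proof.
rewrite !in_itv /= => /andP[t0 t1] /andP[tau0 tau1].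
by rewrite le_min t0 tau0 ge_min t1.
Qed.

Lemma varied_curve_lift u gamma Gam tau y :
    (forall t : R, t \in `[0, 1] -> u t \in V1 G) -> tau \in `[0, 1] ->
    lift_of G u gamma -> Gam 0 = 0 ->
    (forall t : R, t \in `[0, 1] -> is_derive t 1 Gam (gamma t)) ->
  lift_of G (u + step_control tau y) (varied_curve gamma Gam tau y).
Proof.
move=> uV1 tau01 lg Gam0 dGam.
have /choice[nu1 nu1E] (i : 'I_N) : exists nu, forall x, lie G y x 0 i = dot nu x.
  by apply: linear_dot => a v w; rewrite lieDr lieZr.
have /choice[nu2 nu2E] (i : 'I_N) : exists nu, forall x, lie G x y 0 i = dot nu x.
  by apply: (@linear_dot (fun x => lie G x y)) => a v w; rewrite lieDl lieZl.
have coordE i : (fun s => varied_curve gamma Gam tau y s 0 i) = fun s =>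
    dot (delta_mx 0 i) (gamma s) + Num.min s tau * y 0 i +
    Num.min s tau * (2^-1 * dot (nu1 i) (gamma s)) + dot (nu2 i) (Gam (Num.min s tau)).
  by apply: funext => s; rewrite /varied_curve !mxE nu1E nu2E dot_delta mulrA.
have acphi : abs_continuous (fun s => Num.min s tau).
  apply: (lipschitz_abs_continuous (A := 1)) => a b a0 ab b1.
  rewrite mul1r !minEle; case: (lerP a tau) => atau; case: (lerP b tau) => btau;
    rewrite ?ler_norml; apply/andP; split; lra.
have accst (c : R) : abs_continuous (fun=> c).
  by apply: (lipschitz_abs_continuous (A := 0)) => a b _ _ _; rewrite subrr normr0 mul0r.
have [g0 acg dg] := lg.
split.
- rewrite /varied_curve min_l; last by move: tau01; rewrite in_itv /= => /andP[].
  by rewrite g0 Gam0 mul0r !scale0r lie0l !addr0.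
- apply: abs_continuous01_coord => i; rewrite coordE.
  have acgi nu : abs_continuous (fun s => dot nu (gamma s)) := abs_continuous01_dot nu acg.
  apply: abs_continuousD; first apply: abs_continuousD; first apply: abs_continuousD.
  + exact: acgi.
  + exact: abs_continuousM.
  + by apply: abs_continuousM => //; apply: abs_continuousM.
  have [B B0 gB] := abs_continuous_bounded (acgi (nu2 i)).
  have lipG := is_derive_lipschitz (fun t t01 => is_derive_dot (nu2 i) (dGam t t01)) gB.
  apply: (abs_continuous_le B0 acphi acphi) => a b a0 ab b1.
  have a01 : a \in `[0, 1] by rewrite in_itv /= a0 (le_trans ab).
  have b01 : b \in `[0, 1] by rewrite in_itv /= b1 (le_trans a0).
  have minab : Num.min a tau <= Num.min b tau by rewrite le_min2.
  have := min_itv01 a01 tau01; have := min_itv01 b01 tau01; rewrite !in_itv /=.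
  move=> /andP[_ mb1] /andP[ma0 _]; apply: le_trans (lipG _ _ ma0 minab mb1) _.
  rewrite ler_pM2l// ger0_norm ?subr_ge0// -[leLHS]addr0 lerD2l.
  by rewrite subr_ge0.
(* The corner of [Num.min t tau] at t = tau is discarded as a null set. *)
have neqtau : {ae mu, forall t : R, t != tau}.
  exists [set tau]; split=> //; first exact: lebesgue_measure_set1.
  by move=> t /= /negP; rewrite negbK => /eqP.
move: dg neqtau; apply: filterS2; first exact: (ae_filter_ringOfSetsType mu).
move=> t dg tn t01; rewrite diff_mulG; apply/is_derive_rowP => i; rewrite coordE.
have {}dg : is_derive t 1 gamma (u t + 2^-1 *: lie G (gamma t) (u t)).
  by rewrite -diff_mulG; exact: dg.
have dphi := is_derive_min tn; set phi' := (_)%:R in dphi.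
have dGphi : is_derive t 1 (fun s => dot (nu2 i) (Gam (Num.min s tau))) (dot (nu2 i) (gamma (Num.min t tau)) * phi').
  have := dGam _ (min_itv01 t01 tau01) => /(is_derive_dot (nu2 i)) dGam'.
  exact: (@is_derive1_comp _ (fun s => dot (nu2 i) (Gam s)) (fun s => Num.min s tau) t _ _ dGam' dphi).
have d1 := is_deriveD (is_deriveD (is_deriveD (is_derive_dot (delta_mx 0 i) dg)
   (is_deriveM dphi (is_derive_cst (y 0 i) t 1)))
   (is_deriveM dphi (is_deriveM (is_derive_cst (2^-1 : R) t 1) (is_derive_dot (nu1 i) dg)))) dGphi.
set dd := (X in is_derive _ _ _ X) in d1 *.
set ee := (X in is_derive _ _ _ X); suff -> : ee = dd by exact: d1.
(* Where phi' is nonzero, t < tau and the minimum is t. *)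
have phiE : dot (nu2 i) (gamma (Num.min t tau)) * phi' = phi' * dot (nu2 i) (gamma t).
  rewrite /phi'; case: (ltP t tau) => [ltt|_]; last by rewrite mulr0 mul0r.
  by rewrite mulrC.
have cE : (cst (2^-1 : R) * (fun s => dot (nu1 i) (gamma s))) t = 2^-1 * dot (nu1 i) (gamma t) by [].
rewrite /ee /dd phiE cE /GRing.scale /= dot_delta -nu2E -!nu1E.
rewrite /varied_curve fctE /step_control -/phi'.
rewrite !(lieDl, lieDr, lieZl, lieZr, lie_step2, lie_step2l, liexx, scaler0, addr0, mul0r, mulr0).
rewrite (lie_antisym G (gamma t) y).
by rewrite !mxE; field.
Qed.

End Variation.

(** * Square integrable controls and the differential of the endpoint map *)

Section Endpoint.
Variables (R : realType) (N : nat) (G : carnot2 R N).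
Local Notation g := 'rV[R]_N.
Local Notation mu := (@lebesgue_measure R).
Local Notation I01 := (`[0, 1]%classic : set R).

Lemma sqr_integrableP (f : R -> R) : measurable_fun I01 f ->
  (\int[mu]_(t in I01) (f t ^+ 2)%:E < +oo)%E <->
  mu.-integrable I01 (EFin \o (fun t => f t ^+ 2)).
Proof.
move=> mf; have mf2 : measurable_fun I01 (fun t => f t ^+ 2) by exact: measurable_funX.
have absE : (\int[mu]_(t in I01) `|(EFin \o (fun t => f t ^+ 2)%R) t| =
    \int[mu]_(t in I01) (f t ^+ 2)%:E)%E.
  by apply: eq_integral => t _ /=; rewrite ger0_norm// sqr_ge0.
split=> [fin|/integrableP[_]]; last by rewrite absE.
by apply/integrableP; split; [exact/measurable_EFinP|rewrite absE].
Qed.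

Lemma L2control_lin a v w : L2control G v -> L2control G w -> L2control G (a *: v + w).
Proof.
move=> [mv iv vV] [mw iw wV]; have mvw i : measurable_fun I01 (fun t => (a *: v + w) t 0 i).
  have := measurable_funD (measurable_funM (measurable_cst a) (mv i)) (mw i).
  by apply: eq_measurable_fun => t _; rewrite /= !mxE.
split=> // [i|t t01]; last by rewrite rpredD ?rpredZ ?vV ?wV.
apply/(sqr_integrableP (mvw i)).
have I1 := (sqr_integrableP (mv i)).1 (iv i); have I2 := (sqr_integrableP (mw i)).1 (iw i).
(* Domination comes from (a v + w)^2 <= 2 a^2 v^2 + 2 w^2. *)
have I3 : mu.-integrable I01 (fun t => (2 * a ^+ 2)%:E * (v t 0 i ^+ 2)%:E + 2%:E * (w t 0 i ^+ 2)%:E)%E.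
  by apply: integrableD => //; apply: integrableZl.
apply: (le_integrable _ _ _ I3) => //.
  by apply/measurable_EFinP; apply: measurable_funX; exact: mvw.
move=> t _ /=; rewrite lee_fin !mxE ger0_norm ?sqr_ge0// ger0_norm.
  by have := sqr_ge0 (a * v t 0 i - w t 0 i); rewrite !expr2; nra.
by rewrite addr_ge0// mulr_ge0 ?sqr_ge0// mulr_ge0 ?sqr_ge0.
Qed.

Lemma L2control_step tau y : y \in V1 G -> L2control G (step_control tau y).
Proof.
move=> yV1; have mstep i : measurable_fun I01 (fun t => step_control tau y t 0 i).
  have mi : measurable_fun I01 (\1_(`]-oo, tau[%classic) : R -> R).
    by apply: measurable_funTS; apply: measurable_indic; exact: measurable_itv.
  have := measurable_funM mi (measurable_cst (y 0 i)).
  apply: eq_measurable_fun => t _; rewrite /= indicE /step_control mxE.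
  by congr (_%:R * _); rewrite mem_setE /= in_itv.
split=> // [i|t _]; last by rewrite rpredZ.
apply/(sqr_integrableP (mstep i)).
have I1 : mu.-integrable I01 (EFin \o cst (y 0 i ^+ 2)).
  apply: continuous_compact_integrable; first exact: segment_compact.
  exact/continuous_subspaceT/cst_continuous.
apply: (le_integrable _ _ _ I1) => //.
  by apply/measurable_EFinP; apply: measurable_funX; exact: mstep.
move=> t _ /=; rewrite lee_fin !ger0_norm ?sqr_ge0// /step_control mxE.
by case: (t < tau)%R; rewrite ?mulr1n ?mulr0n ?mul1r// mul0r expr0n sqr_ge0.
Qed.

Lemma L2normZ a v : L2control G v -> L2norm (a *: v) = `|a| * L2norm v.
Proof.
move=> [mv iv _]; rewrite /L2norm -sqrtr_sqr -sqrtrM ?sqr_ge0//; congr Num.sqrt.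
rewrite mulr_sumr; apply: eq_bigr => i _.
have I1 := (sqr_integrableP (mv i)).1 (iv i).
rewrite -RintegralZl//.
by apply: eq_Rintegral => t _; rewrite mxE exprMn.
Qed.

(** A subspace of maximal dimension inside I absorbs every element of I; it misses p, and a
    separating form applies. *)
Lemma proper_subspace_form (I : set g) : I 0 ->
    (forall a x y, I x -> I y -> I (a *: x + y)) -> (exists p, ~ I p) ->
  exists2 lam, lam != 0 & forall x, I x -> dot lam x = 0.
Proof.
move=> I0 Ilin [p Ip].
pose P d := `[< exists U : {vspace g}, (forall x, x \in U -> I x) /\ \dim U = d >].
have P0 : exists d, P d.
  by exists 0%N; apply/asboolP; exists 0%VS; rewrite dimv0; split=> // x; rewrite memv0 => /eqP->.
have Pub d : P d -> (d <= \dim (fullv : {vspace g}))%N.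
  by move=> /asboolP[U [_ <-]]; exact/dimvS/subvf.
case: (ex_maxnP P0 Pub) => m /asboolP[U [UI <-]] maxU.
have IU x : I x -> x \in U.
  move=> Ix; have : (\dim (U + <[x]>) <= \dim U)%N.
    apply: maxU; apply/asboolP; exists (U + <[x]>)%VS; split=> // z.
    by case/memv_addP => y yU [_ /vlineP[k ->] ->]; rewrite addrC; apply: Ilin => //; exact: UI.
  move=> dimU; have /eqP -> : U == (U + <[x]>)%VS by rewrite eqEdim addvSl.
  by apply: subvP (addvSr _ _) _ (memv_line _).
have pU : p \notin U by apply: contra_notN Ip => /UI.
have [lam [lamU lamp]] := separating_form pU; exists lam; last by move=> x /IU /lamU.
apply: contra_neq lamp => ->; rewrite /dot big1// => i _.
by rewrite mxE mul0r.
Qed.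

(** By [varied_curve_lift], [End] is exactly affine along the line through u in the direction of the
    step control, so the differential is its slope. *)
Lemma End_differential_step u gamma Gam D tau y :
    L2control G u -> lift_of G u gamma -> Gam 0 = 0 ->
    (forall t : R, t \in `[0, 1] -> is_derive t 1 Gam (gamma t)) ->
    End_differential G u D -> tau \in `[0, 1] -> y \in V1 G ->
  D (step_control tau y) =
  tau *: y + (tau / 2) *: lie G y (gamma 1) + lie G (Gam tau) y.
Proof.
move=> [_ _ uV1] lg Gam0 dGam [Dlin _ Ddiff] tau01 yV1.
have i1 : (1 : R) \in `[0, 1] by rewrite in_itv /= ler01 lexx.
set T := (RHS); pose v := step_control tau y.
have v2 : L2control G v by exact: L2control_step.
have z2 : L2control G (0 : R -> g).
  rewrite (_ : (0 : R -> g) = step_control tau 0); first by apply: L2control_step; rewrite mem0v.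
  by apply: funext => t; rewrite /step_control scaler0.
have D0 : D 0 = 0.
  have := Dlin 1 0 0 z2 z2; rewrite scaler0 addr0 scale1r => /eqP.
  by rewrite -subr_eq0 opprD addrA subrr sub0r oppr_eq0 => /eqP.
have EndE e : End G (u + e *: v) - End G u = e *: T.
  have eyV1 : e *: y \in V1 G by rewrite rpredZ.
  have -> : e *: v = step_control tau (e *: y).
    by apply: funext => t; rewrite fctE /v /step_control !scalerA mulrC.
  rewrite (End_lift uV1 lg).
  rewrite (End_lift _ (varied_curve_lift (e *: y) uV1 tau01 lg Gam0 dGam)); last first.
    by move=> t t01; rewrite rpredD ?uV1 ?rpredZ.
  rewrite /varied_curve min_r; last by move: tau01; rewrite in_itv /= => /andP[].
  rewrite /T !lieZl !lieZr; apply/rowP => i; rewrite !mxE; ring.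
apply/esym/eqP; rewrite -subr_eq0 -normr_le0; apply/ler_addgt0Pr => e e0; rewrite add0r.
have n0 : 0 <= L2norm v by exact: sqrtr_ge0.
have n1 : 0 < L2norm v + 1 by rewrite ltr_wpDl.
have [d d0 dP] := Ddiff (e / (L2norm v + 1)) (divr_gt0 e0 n1).
(* Dividing by the norm plus 1 brings a *: v into the ball of radius d without dividing by zero. *)
pose a := d / (L2norm v + 1); have a0 : 0 < a by rewrite divr_gt0.
have av2 : L2control G (a *: v) by have := L2control_lin a v2 z2; rewrite addr0.
have := dP (a *: v) av2; rewrite L2normZ// gtr0_norm// EndE.
have -> : D (a *: v) = a *: D v by have := Dlin a v 0 v2 z2; rewrite addr0 D0 addr0.
rewrite -scalerBr normrZ gtr0_norm// => H.
have : a * `|T - D v| <= e / (L2norm v + 1) * (a * L2norm v).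
  by apply: H; rewrite /a mulrAC ltr_pdivrMr// ltr_pM2l// ltrDl.
rewrite mulrCA ler_pM2l// => /le_trans; apply.
by rewrite mulrAC ler_pdivrMr// ler_pM2l// lerDl.
Qed.

(* Testing the differential on the controls equal to y on [0, tau] gives an
   identity in tau; its derivative says lam [gamma tau, y] is constant, hence 0. *)
Lemma Abn_abnormal_point p : Abn G p ->
  p = (point : R -> g) 1 \/ exists lam, abnormal_point G lam p.
Proof.
move=> [u [u2 [D dD [_ Dproper]] ->]].
have [[gamma lg]|nolift] := pselect (exists gamma, lift_of G u gamma); last first.
  (* Without a lift, [get] returns a default curve and [End u] is one fixed point. *)
  by left; rewrite /End /curve getPN// => gamma lg; apply: nolift; exists gamma.
right; have [_ _ uV1] := u2; rewrite (End_lift uV1 lg).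
have [Gam Gam0 dGam] := lift_primitive lg.
have z2 : L2control G (step_control 0 0) by apply: L2control_step; rewrite mem0v.
have zE : step_control 0 0 = 0 :> (R -> g) by apply: funext => t; rewrite /step_control scaler0.
have [Dlin _ _] := dD.
have [||| lam lam0 lamD] := @proper_subspace_form (D @` L2control G).
- exists (step_control 0 0) => //; rewrite (End_differential_step u2 lg Gam0 dGam dD) ?mem0v//.
    by rewrite Gam0 !lie0l mul0r !scale0r !addr0.
  by rewrite in_itv /= lexx ler01.
- move=> a _ _ [v v2 <-] [w w2 <-]; exists (a *: v + w); first exact: L2control_lin.
  exact: Dlin.
- by apply: contrapT => H; apply: Dproper => x _; apply: contrapT => nx; apply: H; exists x.
have i0 : (0 : R) \in `[0, 1] by rewrite in_itv /= lexx ler01.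
have i1 : (1 : R) \in `[0, 1] by rewrite in_itv /= ler01 lexx.
have g0 : gamma 0 = 0 by case: lg.
(* The terms of lam (D (step_control tau y)) linear in tau; the other term is lam [Gam tau, y]. *)
pose c y := dot lam y + 2^-1 * dot lam (lie G y (gamma 1)).
have F0 y tau : y \in V1 G -> tau \in `[0, 1] -> tau * c y + dot lam (lie G (Gam tau) y) = 0.
  move=> yV1 tau01; rewrite -(lamD (D (step_control tau y))); last first.
    by exists (step_control tau y) => //; exact: L2control_step.
  rewrite (End_differential_step u2 lg Gam0 dGam dD tau01 yV1) !dotD !dotZ /c; ring.
have dF y tau : y \in V1 G -> tau \in `[0, 1] -> c y + dot lam (lie G (gamma tau) y) = 0.
  move=> yV1 tau01.
  pose nu : g := \row_i dot lam (lie G (delta_mx 0 i) y).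
  have nuE x : dot nu x = dot lam (lie G x y).
    rewrite [in RHS](row_sum_delta x) lie_suml dot_sum; apply: eq_bigr => i _.
    by rewrite mxE lieZl dotZ mulrC.
  apply: (@is_derive_eq0_itv R ((c y \*: id) + (fun s => dot nu (Gam s))) tau _ tau01).
    by move=> s s01; rewrite -[RHS](F0 y s yV1 s01) -nuE fctE /= /GRing.scale /= mulrC.
  have := is_deriveD (is_deriveZ (c y) (is_derive_id tau (1 : R))) (is_derive_dot nu (dGam tau tau01)).
  by rewrite nuE /GRing.scale /= mulr1.
(* At tau = 0 the curve is at the identity, which isolates c y. *)
have c0 y : y \in V1 G -> c y = 0.
  by move=> yV1; have := dF y 0 yV1 i0; rewrite g0 lie0l dot0 addr0.
have lamg y tau : tau \in `[0, 1] -> y \in V1 G -> dot lam (lie G (gamma tau) y) = 0.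
  by move=> tau01 yV1; have := dF y tau yV1 tau01; rewrite c0// add0r.
exists lam; split=> //; last first.
  move=> nu nuW nuWW; apply: (lift_confined uV1 lg _ nuW nuWW) => t y; exact: lamg.
(* At tau = 1 the bracket in c y vanishes, leaving lam y = 0. *)
move=> y yV1; have := c0 y yV1.
by rewrite /c lie_antisym dotN lamg// oppr0 mulr0 addr0.
Qed.

End Endpoint.

Theorem mainTheorem2 (R : realType) (N : nat) (G : carnot2 R N)
    (hN : (N <= 7)%N) :
  exists Z : set 'rV[R]_N,
    [/\ algebraic Z, codim_ge Z 3 & Abn G `<=` Z].
Proof.
(* The extra point is the default endpoint of controls without a lift. *)
apply: (@small_codimS _ _ _ _ ([set (point : R -> 'rV[R]_N) 1] `|`
    [set p | exists lam, abnormal_point G lam p])).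
  by move=> p /Abn_abnormal_point [->|]; [left|right].
apply: small_codimU; first exact: small_codim_set1 (carnot2_dim_ge3 G).
exact: small_codim_abnormal_points.
Qed.
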